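(* Suppose that the following hold. (A1) (i) $\operatorname{dom}\partial h(\cdot,z)=S$ for all $z\in\Xi$. (ii) $\bar\rho:=\rho_H+\inf_{z\in\Xi}\rho(g(\cdot,z))>0$. (iii) There is a Borel measurable map $\tau:S\times\Xi\to\mathbb{R}^m$ with $\tau(w,z)\in\partial_w h(w,z)$ for all $w\in S$, $z\in\Xi$, and a Borel measurable function $\tilde\tau$ such that $\tilde\tau(Z)^2$ is integrable and $\|\tau(w,z)\|\le\tilde\tau(z)$ for all $w\in S$, $z\in\Xi$. (iv) $\sup_{w\in S}|F(w)|<+\infty$. (A2) (i) There is a Borel measurable function $\tilde g:\mathbb{R}^n\to\mathbb{R}$ such that $\tilde g(Z)$ is integrable and $|g(w,z)|\le\tilde g(z)$ for all $w\in S$, $z\in\Xi$. (ii) There are constants $N_g>0$ and $\alpha>0$ such that $R_k(g,\Xi)\le N_g/k^{\alpha}$ for all integers $k\ge1$. Let $\beta=\min\{\alpha,1\}$ and let $\{n_k\}_{k\ge0}$ be a sequence of positive integers with $\sum_{k=1}^{\infty}n_k^{-\beta}<+\infty$. Let $\{w^k\}_{k\ge0}$ be generated by the online stochastic DCA described in the context, with sample sizes $\{n_k\}$ and selector $\tau$. Then: 1. There exists an integrable random variable $F^\infty$ such that $F(w^k)\to F^\infty$ almost surely. 2. $\sum_{k=1}^{\infty}\|w^{k+1}-w^k\|^2<+\infty$ almost surely. 3. There exists a measurable set $\mathcal{L}\subset\Omega$ with $\mathbb{P}(\mathcal{L})=1$ such that for each $\omega\in\mathcal{L}$, every limit point of $\{w^k(\omega)\}$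 is a critical point of $F=G-H$.
   Context: Setting. $S\subset\mathbb{R}^m$ is a nonempty, compact, convex set. $(\Omega,\mathcal{M},\mathbb{P})$ is a complete probability space, $Z:\Omega\to\mathbb{R}^n$ is a random vector with distribution $P_Z$, and $\Xi=\operatorname{supp}(P_Z)$ is the (closed) support of $P_Z$, i.e. the set of points all of whose neighborhoods have positive $P_Z$-measure. The functions $g,h:\mathbb{R}^m\times\mathbb{R}^n\to\mathbb{R}\cup\{+\infty\}$ are Borel measurable, are finite on $S\times\Xi$ and equal $+\infty$ outside $S\times\Xi$. For all $w\in S$, $g(w,Z)$ and $h(w,Z)$ are integrable. For all $z\in\Xi$, $g(\cdot,z)$ and $h(\cdot,z)$ are convex and lower semicontinuous on $\mathbb{R}^m$. Put $G(w)=\mathbb{E}(g(w,Z))$ and $H(w)=\mathbb{E}(h(w,Z))$; these have effective domain $S$ (value $+\infty$ outside $S$), are convex, and are assumed lower semicontinuous. Put $F=G-H$ (convention $+\infty-(+\infty)=+\infty$). The underlying problem is $\min_{w\in S}F(w)$. Notation. For a convex function $\theta$ on $\mathbb{R}^m$: $\rho(\theta)=\sup\{\mu\ge0:\theta-\frac{\mu}{2}\|\cdot\|^2\text{ is convex on }\mathbb{R}^m\}$ is the modulus of strong convexity, and $\rho_H=\rho(H)$. For $x_0$ in the effective domain of $\theta$, $\partial\theta(x_0)=\{y:\theta(x)\ge\theta(x_0)+\langle x-x_0,y\rangle\ \forall x\in\mathbb{R}^m\}$; $\operatorname{dom}\partial\theta$ is the set of points where $\partial\theta$ is nonempty; $\partial_w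 h(w,z)$ denotes the subdifferential of $h(\cdot,z)$ at $w$. A point $w^*$ is a critical point of $G-H$ if $\partial G(w^* )\cap\partial H(w^* )\ne\emptyset$. Rademacher average. For $z_1,\dots,z_l\in\Xi$, $R_l(g,z^l)=\mathbb{E}_\sigma\sup_{w\in S}\left|\frac1l\sum_{i=1}^l\sigma_i g(w,z_i)\right|$, where $\sigma_1,\dots,\sigma_l$ are i.i.d. with $\mathbb{P}(\sigma_i=1)=\mathbb{P}(\sigma_i=-1)=1/2$; and $R_l(g,\Xi)=\sup_{z_1,\dots,z_l\in\Xi}R_l(g,z^l)$. Online stochastic DCA. Choose $w^0\in S$. For $k=0,1,2,\dots$: (1) draw $n_k$ independent samples $Z_{k,1},\dots,Z_{k,n_k}$ from the distribution of $Z$, independent also of the past, i.e. of the $\sigma$-algebra $\mathcal{P}_k$ generated by all samples $Z_{j,i}$ with $j<k$ and by $w^0,\dots,w^k$; (2) set $t^k=\frac1{n_k}\sum_{i=1}^{n_k}\tau(w^k,Z_{k,i})$; (3) choose $w^{k+1}\in\arg\min_{w\in\mathbb{R}^m}\left\{\frac1{n_k}\sum_{i=1}^{n_k}g(w,Z_{k,i})-\langle t^k,w\rangle\right\}$. The iterates $w^k$ are random vectors (measurable), and the algorithm is well defined on the probability-one event that all samples lie in $\Xi$. *)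

(* Defs.v *)
From HB Require Import structures.
From mathcomp Require Import all_boot all_order all_algebra.
From mathcomp Require Import all_classical all_reals all_analysis.
From mathcomp Require Import measurable_realfun.

Set Implicit Arguments.
Unset Strict Implicit.
Unset Printing Implicit Defensive.

Import Order.TTheory GRing.Theory Num.Theory.
Import numFieldNormedType.Exports.

Local Open Scope classical_set_scope.
Local Open Scope ring_scope.

(* Borel sigma-algebra. By second countability the product sigma-algebra on
   'rV[R]_m * 'rV[R]_n is the Borel sigma-algebra of the product space. *)
HB.instance Definition _ (R : realType) (m n : nat) :=
  @isMeasurable.Build (sigma_display (@open 'M[R]_(m, n))) 'M[R]_(m, n)
    <<s @open 'M[R]_(m, n) >> (@sigma_algebra0 _ setT open)
    (@sigma_algebraC _ open) (@sigma_algebra_bigcup _ setT open).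

(* The library norm on 'rV[R]_m is the sup norm; the Euclidean structure is
   the following one. *)
Definition dotv (R : realType) (m : nat) (x y : 'rV[R]_m) : R :=
  \sum_(i < m) x ord0 i * y ord0 i.

Definition enorm (R : realType) (m : nat) (x : 'rV[R]_m) : R :=
  Num.sqrt (dotv x x).

Section ConvexAnalysis.
Context {R : realType} {m : nat}.
Implicit Types f : 'rV[R]_m -> \bar R.
Local Open Scope ereal_scope.

(* Only meant for functions that never take the value -oo. *)
Definition econvex f := forall (x y : 'rV[R]_m) (t : R), (0 <= t <= 1)%R ->
  f (t *: x + (1 - t) *: y)%R <= t%:E * f x + (1 - t)%:E * f y.

Definition strong_convexity_modulus f : \bar R :=
  ereal_sup [set mu%:E | mu in
    [set mu : R | (0 <= mu)%R /\
      econvex (fun x => f x - (mu / 2 * enorm x ^+ 2)%:E)]].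

Definition subdiff f (x0 : 'rV[R]_m) : set 'rV[R]_m :=
  [set y | f x0 < +oo /\ forall x, f x0 + (dotv (x - x0)%R y)%:E <= f x].

Definition argmin f : set 'rV[R]_m := [set x | forall y, f x <= f y].

(* G - H with the convention +oo - (+oo) = +oo; the library has
   +oo - (+oo) = -oo. *)
Definition dc_diff (G H : 'rV[R]_m -> \bar R) (x : 'rV[R]_m) : \bar R :=
  if (G x == +oo) && (H x == +oo) then +oo else G x - H x.

Definition critical_point (G H : 'rV[R]_m -> \bar R) (x : 'rV[R]_m)
    : Prop :=
  subdiff G x `&` subdiff H x !=set0.

End ConvexAnalysis.

Section StochasticDCA.
Context {R : realType} {m n : nat}.
Local Open Scope ereal_scope.

Definition msupp (mu : set 'rV[R]_n -> \bar R) : set 'rV[R]_n :=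
  [set z | forall U, open_nbhs z U -> 0 < mu U].

Definition mean_fun d (T : measurableType d) (P : probability T R)
    (Z : {RV P >-> 'rV[R]_n}) (f : 'rV[R]_m -> 'rV[R]_n -> \bar R)
    (w : 'rV[R]_m) : \bar R :=
  \int[P]_o f w (Z o).

(* The expectation over l independent uniform signs is the average over the
   2 ^ l sign patterns; [true] stands for the sign -1. *)
Definition rademacher_avg (S : set 'rV[R]_m)
    (g : 'rV[R]_m -> 'rV[R]_n -> \bar R) (l : nat) (z : 'I_l -> 'rV[R]_n)
    : \bar R :=
  (2 ^- l)%:E * \sum_(s : {ffun 'I_l -> bool})
    ereal_sup [set `| l%:R^-1%:E *
                      \sum_(i < l) ((-1) ^+ s i)%:E * g w (z i) | | w in S].

Definition rademacher (S : set 'rV[R]_m) (Xi : set 'rV[R]_n)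
    (g : 'rV[R]_m -> 'rV[R]_n -> \bar R) (l : nat) : \bar R :=
  ereal_sup [set rademacher_avg S g z | z in
    [set z : 'I_l -> 'rV[R]_n | forall i, Xi (z i)]].

Context d (T : measurableType d) (P : probability T R).
Variables (N : nat -> nat) (Zs : forall k, 'I_(N k) -> {RV P >-> 'rV[R]_n})
  (w : nat -> {RV P >-> 'rV[R]_m}).

Definition past (k : nat) : set (set T) :=
  <<s (\bigcup_(j in `I_k) \bigcup_(i in [set: 'I_(N j)])
         g_sigma_algebra_preimage (Zs i))
      `|` \bigcup_(j in `I_k.+1) g_sigma_algebra_preimage (w j) >>.

(* The sigma-algebras [past k], sigma(Zs k 0), ..., sigma(Zs k (N k).-1) are
   mutually independent. Subfamilies are covered by taking [B] or some [A i]
   to be the full set. *)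
Definition fresh_samples (Z : {RV P >-> 'rV[R]_n}) (k : nat) : Prop :=
  (forall (i : 'I_(N k)) (A : set 'rV[R]_n), measurable A ->
     distribution P (Zs i) A = distribution P Z A) /\
  (forall (B : set T) (A : 'I_(N k) -> set 'rV[R]_n), past k B ->
     (forall i, measurable (A i)) ->
     P (B `&` \bigcap_(i in [set: 'I_(N k)]) (Zs i @^-1` A i)) =
     P B * \prod_(i < N k) P (Zs i @^-1` A i)).

Definition dca_slope (tau : 'rV[R]_m -> 'rV[R]_n -> 'rV[R]_m) (k : nat) (o : T)
    : 'rV[R]_m :=
  ((N k)%:R^-1 *: \sum_(i < N k) tau (w k o) (Zs i o))%R.

Definition dca_objective (g : 'rV[R]_m -> 'rV[R]_n -> \bar R)
    (tau : 'rV[R]_m -> 'rV[R]_n -> 'rV[R]_m) (k : nat) (o : T) (v : 'rV[R]_m)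
    : \bar R :=
  (N k)%:R^-1%:E * \sum_(i < N k) g v (Zs i o)
    - (dotv (dca_slope tau k o) v)%:E.

(* Off the event that every sample lies in [Xi] the iterates are only required
   to be measurable. *)
Definition online_stochastic_dca (S : set 'rV[R]_m) (Xi : set 'rV[R]_n)
    (Z : {RV P >-> 'rV[R]_n}) (g : 'rV[R]_m -> 'rV[R]_n -> \bar R)
    (tau : 'rV[R]_m -> 'rV[R]_n -> 'rV[R]_m) : Prop :=
  [/\ forall o, S (w 0%N o),
      forall k, fresh_samples Z k &
      forall o, (forall k (i : 'I_(N k)), Xi (Zs i o)) ->
        forall k, argmin (dca_objective g tau k o) (w k.+1 o)].

End StochasticDCA.

(* Main.v *)
Require Import Defs.
From HB Require Import structures.
From mathcomp Require Import all_boot all_order all_algebra.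
From mathcomp Require Import all_classical all_reals all_analysis.
From mathcomp Require Import measurable_realfun.
From mathcomp Require Import ring lra.

Set Implicit Arguments.
Unset Strict Implicit.
Unset Printing Implicit Defensive.

Import Order.TTheory GRing.Theory Num.Theory.
Import numFieldNormedType.Exports.

Local Open Scope classical_set_scope.
Local Open Scope ring_scope.

(** The theorem holds because each step of the algorithm decreases F up to an
    error whose expectation is summable, so that almost surely everything
    reduces to a deterministic statement about real sequences.

    Let G_k be the average of the functions g(., Z_{k,i}) over the k-th batch,
    t_k the slope, tb(w) the expectation of tau(w, Z), Delta_k the supremum over
    S of |G_k - G| and e_k = |t_k - tb(w_k)|^2.  By construction t_k is a
    subgradient of G_k at w_{k+1} and tb(w_k) is a subgradient of H at w_k.
    Comparing both functions at the midpoint of w_k and w_{k+1}, where strong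
    convexity leaves a quadratic surplus, and then replacing G_k by G gives
      F(w_{k+1}) <= F(w_k) - c |w_{k+1} - w_k|^2 + 2 Delta_k + e_k / (4 c)
    with some c > 0 (strong_convexity_split, dca_descent_step).

    The two error terms have expectations of order n_k^(-alpha) and n_k^(-1).
    For Delta_k this is symmetrization with a ghost sample followed by the bound
    on the Rademacher averages (symmetrization, uniform_deviation).  For e_k it
    is the variance of an average of n_k vectors that are independent and
    identically distributed once w_k is fixed (integral_slope_noise_le).  As
    the sum of the n_k^(-beta) is finite, the sum of the errors is almost surely
    finite (ae_summable).  On that event F(w_k) plus the sum of the errors still
    to come is nonincreasing and bounded below, which yields the convergence of
    F(w_k) and the summability of |w_{k+1} - w_k|^2 (perturbed_descent_cvg,
    perturbed_descent_summable); no martingale argument is involved.  Moreover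
    Delta_k, e_k and w_{k+1} - w_k tend to 0, so along a subsequence the two
    subgradient inequalities pass to the limit by lower semicontinuity and
    share a common subgradient (limit_point_critical).

    The delicate point is that Delta_k has to be measurable and that w_{k+1} is
    an arbitrary measurable selection of minimizers, while the functions
    g(., z) may be discontinuous on the relative boundary of S.  It is settled
    by geometry: for each t in (0, 1] there is a finite subset of S that meets
    every homothetic copy (1 - t) w + t S with w in S (finite_homothetic_net).
    Convexity bounds a function from above at the points so obtained and lower
    semicontinuity bounds it from below, so its value at w is the limit of its
    values along one sequence that does not depend on the function
    (exists_dense_nets).  Hence Delta_k is bounded by a supremum over a
    countable set. *)

(** * Relative interior points and homothetic nets of convex sets *)

Section RelativeInterior.
Context {R : realType} {m : nat}.
Implicit Types (S : set 'rV[R]_m).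

Lemma convex_set_comb S :
  convex_set (S : set (convex_lmodType 'rV[R]_m)) ->
  forall x y (t : R), S x -> S y -> 0 <= t <= 1 -> S (t *: x + (1 - t) *: y).
Proof.
move=> cS x y t Sx Sy t01.
have := cS x y (@Itv01 R t (proj1 (andP t01)) (proj2 (andP t01))).
by rewrite !inE; apply.
Qed.

(** Weighted points with a zero or positive total weight are closed under
    addition, so binary convexity propagates through the sum. *)
Lemma convex_sum S (cS : forall x y (t : R), S x -> S y -> 0 <= t <= 1 ->
    S (t *: x + (1 - t) *: y)) r (l : 'I_r -> R) (x : 'I_r -> 'rV[R]_m) :
  (forall i, 0 <= l i) -> (forall i, S (x i)) -> \sum_i l i = 1 ->
  S (\sum_i l i *: x i).
Proof.
move=> l0 Sx l1.
pose K (s : R) v := (s = 0 /\ v = 0) \/ (0 < s /\ S (s^-1 *: v)).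
have : K (\sum_i l i) (\sum_i l i *: x i).
  apply: (big_ind2 K); first by left.
    move=> s u t v [[-> ->]|[s0 Su]]; first by rewrite !add0r.
    move=> [[-> ->]|[t0 Sv]]; first by rewrite !addr0; right.
    right; split; first exact: addr_gt0.
    have -> : (s + t)^-1 *: (u + v) =
        (s / (s + t)) *: (s^-1 *: u) + (1 - s / (s + t)) *: (t^-1 *: v).
      rewrite scalerDr !scalerA; congr (_ *: _ + _ *: _); field;
        rewrite ?gt_eqF//; exact: addr_gt0.
    apply: cS => //; apply/andP; split; first by rewrite divr_ge0 ?ltW ?addr_gt0.
    by rewrite ler_pdivrMr ?addr_gt0// mul1r lerDl ltW.
  move=> i _; have := l0 i; rewrite le_eqVlt => /predU1P[<-|li0].
    by left; rewrite scale0r.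
  by right; split=> //; rewrite scalerA mulVf ?scale1r// gt_eqF.
by rewrite l1 => -[[/eqP]|[_]]; rewrite ?oner_eq0// invr1 scale1r.
Qed.

(** A family of directions x - a of maximal rank spans all of them. *)
Lemma exists_spanning_points S a : S a ->
  exists r (A : 'M[R]_(r, m)), (forall i, S (a + row i A)) /\
    forall x, S x -> (x - a <= A)%MS.
Proof.
move=> Sa.
pose Q k := exists r (A : 'M[R]_(r, m)),
  (forall i, S (a + row i A)) /\ \rank A = k.
have Q0 : exists k, `[< Q k >].
  exists 0%N; apply/asboolP; exists 0%N, 0; split; first by case.
  by rewrite mxrank0.
have Qm k : `[< Q k >] -> (k <= m)%N.
  by move=> /asboolP[r [A [_ <-]]]; exact: rank_leq_col.
case: (ex_maxnP Q0 Qm) => k /asboolP[r [A [SA rA]]] kmax.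
exists r, A; split=> // x Sx.
pose B := col_mx A (x - a).
have /asboolP QB : Q (\rank B).
  exists (r + 1)%N, B; split=> // i.
  rewrite /B; case: (split_ordP i) => j ->; first by rewrite rowKu.
  by rewrite rowKd row_id addrC subrK.
have AB : (A <= B)%MS by rewrite -addsmxE addsmxSl.
have BA : (B <= A)%MS.
  rewrite -(mxrank_leqif_sup AB) eqn_leq mxrankS//= rA; exact: kmax.
by apply: submx_trans BA; rewrite -addsmxE addsmxSr.
Qed.

Lemma norm_row_mulmx r (u : 'rV[R]_m) (B : 'M[R]_(m, r)) i :
  `|(u *m B) ord0 i| <= `|u| * \sum_l \sum_j `|B l j|.
Proof.
rewrite mxE (le_trans (ler_norm_sum _ _ _))// mulr_sumr ler_sum// => l _.
rewrite normrM ler_pM//.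
  rewrite [leRHS]/Num.norm /= mx_normrE.
  by apply/bigmax_geP; right => /=; exists (ord0, l).
by rewrite (bigD1 (i : 'I_r))//= lerDl sumr_ge0.
Qed.

(** The barycentre of a point of S and of a maximal independent family of
    directions is a relative interior point: in the coordinates of that family,
    the weights of the barycentre are positive, and the coordinates of x - y
    are controlled by the norm of x - y.  The conclusion says that S contains a
    ball around x0 within the span of the differences of points of S. *)
Lemma exists_relative_interior S :
  convex_set (S : set (convex_lmodType 'rV[R]_m)) -> S !=set0 ->
  exists x0 (d : R), [/\ S x0, 0 < d & forall x y (c : R), S x -> S y -> 0 <= c ->
    c * `|x - y| <= d -> S (x0 + c *: (x - y))].
Proof.
move=> /convex_set_comb cS [a Sa].
have [r [A [SA spanA]]] := exists_spanning_points Sa.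
pose B := pinvmx A.
pose K : R := \sum_l \sum_j `|B l j|.
have K0 : 0 <= K by apply: sumr_ge0 => l _; apply: sumr_ge0.
(* The barycentre gives weight q to each of the r + 1 points. *)
pose q : R := r.+1%:R^-1.
have q0 : 0 < q by rewrite invr_gt0.
have inS (l : 'I_r -> R) : (forall i, 0 <= l i) -> \sum_i l i <= 1 ->
    S (a + \sum_i l i *: row i A).
  move=> l0 l1.
  pose l' (i : 'I_r.+1) := if unlift ord0 i is Some j then l j
    else 1 - \sum_i l i.
  pose x' (i : 'I_r.+1) := if unlift ord0 i is Some j then a + row j A else a.
  have -> : a + \sum_i l i *: row i A = \sum_i l' i *: x' i.
    rewrite big_ord_recl /l' /x' !unlift_none.
    rewrite [in RHS](eq_bigr (fun i => l i *: a + l i *: row i A)); last first.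
      by move=> i _; rewrite liftK scalerDr.
    by rewrite big_split/= -scaler_suml addrA -scalerDl subrK scale1r.
  apply: convex_sum => //.
  - move=> i; rewrite /l'; case: (unliftP ord0 i) => [j _|_]; first exact: l0.
    by rewrite subr_ge0.
  - by move=> i; rewrite /x'; case: (unliftP ord0 i) => [j _|_].
  - rewrite big_ord_recl /l' unlift_none.
    by rewrite [X in _ + X](eq_bigr l) ?subrK// => i _; rewrite liftK.
have rq : r%:R * q = 1 - q by rewrite /q -[r.+1]addn1 natrD; field; rewrite natr1 pnatr_eq0.
(* Coordinates at most q ^+ 2 keep the r weights nonnegative, with sum at most
   r (q + q ^+ 2) = (1 - q) (1 + q) <= 1. *)
exists (a + \sum_i q *: row i A), (q ^+ 2 / (K + 1)); split.
- apply: (inS (fun=> q)) => [i|]; first exact: ltW.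
  by rewrite sumr_const card_ord -mulr_natl rq lerBlDr lerDl ltW.
- by rewrite divr_gt0 ?exprn_gt0// ltr_wpDl.
- move=> x y c Sx Sy c0 cxy.
  have xyA : (x - y <= A)%MS.
    rewrite (_ : x - y = (x - a) - (y - a)); last by rewrite opprB addrA subrK.
    by apply: addmx_sub; [exact: spanA|rewrite eqmx_opp; exact: spanA].
  have -> : c *: (x - y) = \sum_i (c * ((x - y) *m B) ord0 i) *: row i A.
    rewrite -{1}(mulmxKpV xyA) mulmx_sum_row scaler_sumr.
    by apply: eq_bigr => i _; rewrite scalerA.
  rewrite -addrA -big_split/=; under eq_bigr do rewrite -scalerDl.
  have cB i : `|c * ((x - y) *m B) ord0 i| <= q ^+ 2.
    rewrite normrM (ger0_norm c0).
    rewrite (le_trans (ler_wpM2l c0 (norm_row_mulmx _ _ _)))// -/K.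
    rewrite mulrA (le_trans (ler_wpM2r K0 cxy))//.
    rewrite -mulrA ger_pMr ?exprn_gt0// mulrC ler_pdivrMr ?mul1r ?lerDl//.
    by rewrite ltr_wpDl.
  have q1 : q <= 1 by rewrite invf_le1// ler1n.
  apply: inS => [i|].
    have := cB i; rewrite ler_norml => /andP[+ _].
    by rewrite expr2 => h; rewrite -lerBlDl sub0r (le_trans _ h)// lerN2; nra.
  rewrite (@le_trans _ _ (\sum_(i < r) (q + q ^+ 2)))//.
    by apply: ler_sum => i _; rewrite lerD2l (le_trans (ler_norm _)).
  rewrite sumr_const card_ord -mulr_natl mulrDr rq expr2 mulrA rq.
  nra.
Qed.

Lemma compact_finite_net S (e : R) : compact S -> 0 < e ->
  exists C : seq 'rV[R]_m, (forall x, x \in C -> S x) /\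
    forall w, S w -> exists2 u, u \in C & `|u - w| <= e.
Proof.
rewrite compact_cover => cS e0.
have [|x Sx|D SD SU] := cS _ S (fun x : 'rV[R]_m => ball x e).
- by move=> x _; exact: ball_open.
- by exists x => //; exact: ballxx.
exists (finmap.enum_fset D); split.
  by move=> x xD; have := SD x xD; rewrite inE.
move=> w /SU[u uD]; rewrite -ball_normE/= => uw.
by exists u => //; exact: ltW.
Qed.

(** If u belongs to a fine finite net of S and is close to w, then
    (1 - t) u + t x0 = (1 - t) w + t (x0 + ((1 - t) / t) (u - w)),
    and the last point is in S because x0 is in the relative interior. *)
Lemma finite_homothetic_net S (t : R) :
  convex_set (S : set (convex_lmodType 'rV[R]_m)) -> compact S ->
  S !=set0 -> 0 < t <= 1 ->
  exists D : seq 'rV[R]_m, (forall d, d \in D -> S d) /\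
    forall w, S w -> exists2 v, S v & (1 - t) *: w + t *: v \in D.
Proof.
move=> cS kS S0 /andP[t0 t1].
have [x0 [d [Sx0 d0 ri]]] := exists_relative_interior cS S0.
have [C [SC netC]] := compact_finite_net kS (mulr_gt0 d0 t0).
exists [seq (1 - t) *: u + t *: x0 | u <- C]; split.
  move=> _ /mapP[u uC ->].
  have -> : t *: x0 = (1 - (1 - t)) *: x0 by congr (_ *: _); ring.
  by apply: (convex_set_comb cS) => //; [exact: SC|lra].
move=> w Sw; have [u uC uw] := netC w Sw.
exists (x0 + ((1 - t) / t) *: (u - w)).
  apply: ri => //; [exact: SC|by rewrite divr_ge0 ?subr_ge0// ltW|].
  by rewrite mulrAC ler_pdivrMr// (le_trans _ uw)// ler_piMl// lerBlDr lerDl ltW.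
apply/mapP; exists u => //.
rewrite scalerDr scalerA mulrC divfK ?gt_eqF// scalerBr.
by rewrite addrCA addrC addrCA subrr addr0 addrC.
Qed.

End RelativeInterior.

(** * Laws of finite samples and independence *)

Section LawOfSamples.
Context {R : realType}.
Local Open Scope ereal_scope.

(** Rectangles form a pi-system that generates the product sigma-algebra. *)
Lemma tuple_measure_eq_rectangles d (X : measurableType d) N
    (m1 m2 : {measure set (N.-tuple X) -> \bar R}) :
  m1 setT < +oo ->
  (forall A : 'I_N -> set X, (forall i, measurable (A i)) ->
    m1 [set x | forall i, A i (tnth x i)] =
    m2 [set x | forall i, A i (tnth x i)]) ->
  forall B, measurable B -> m1 B = m2 B.
Proof.
move=> m1oo m12.
pose G : set (set (N.-tuple X)) := [set B | exists A : 'I_N -> set X,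
  (forall i, measurable (A i)) /\ B = [set x | forall i, A i (tnth x i)]].
have GT : G setT.
  by exists (fun=> setT); split=> //; apply/seteqP; split.
apply: (measure_unique G (fun=> setT)) => //.
- apply/seteqP; split.
    rewrite /measurable/= /g_sigma_preimage; apply: sub_smallest2r => //=.
    move=> B; rewrite -bigcup_seq/= => -[i _ [C mC <-]].
    exists (fun j => if j == i then C else setT); split.
      by move=> j; case: ifP.
    rewrite setTI; apply/seteqP; split=> x /= Cx.
      by move=> j; case: eqP => // ->.
    by have := Cx i; rewrite eqxx.
  apply: smallest_sub; first exact: sigma_algebra_measurable.
  move=> _ [A [mA ->]].
  rewrite (_ : [set _ | _] =
    \big[setI/setT]_(i < N) (@tnth N X ^~ i @^-1` A i)).
    apply: bigsetI_measurable => i _; rewrite -[X in measurable X]setTI.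
    exact: measurable_tnth.
  rewrite -bigcap_seq; apply/seteqP; split=> x /= h i; first by move=> _; exact: h.
  by apply: h; rewrite /= mem_index_enum.
- move=> _ _ [A [mA ->]] [B [mB ->]].
  exists (fun i => A i `&` B i); split; first by move=> i; exact: measurableI.
  by apply/seteqP; split=> [x [] h1 h2 i|x h]; [|split=> i; have [] := h i].
- by apply/seteqP; split=> // x _; exists 0%N.
- by move=> _ [A [mA ->]]; exact: m12.
Qed.

(** Laws are defined for bundled measurable functions; this bundles a plain one. *)
Lemma exists_mfun d d' (T : measurableType d) (Y : measurableType d') (f : T -> Y)
  (mf : measurable_fun setT f) : exists F : {mfun T >-> Y}, forall x, F x = f x.
Proof. by exists (mfun_Sub (mem_set mf)). Qed.

End LawOfSamples.

Section IndependentIntegrals.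
Context {R : realType} d (T : measurableType d) (P : probability T R).
Local Open Scope ereal_scope.

Lemma EFin_Rintegral (f : T -> R) : P.-integrable setT (EFin \o f) ->
  (\int[P]_o f o)%R%:E = \int[P]_o (f o)%:E.
Proof. by move=> If; rewrite /Rintegral fineK// integrable_fin_num. Qed.

Lemma integrable_of_sqr (f : T -> R) : measurable_fun setT f ->
  P.-integrable setT (fun o => (f o ^+ 2)%:E) -> P.-integrable setT (EFin \o f).
Proof.
move=> mf f2; apply: (@le_integrable _ _ _ _ _ _ _
    (fun o => (1 + f o ^+ 2)%:E)) => //.
- exact/measurable_EFinP.
- move=> o _ /=; rewrite lee_fin [leRHS]ger0_norm ?addr_ge0 ?sqr_ge0//.
  rewrite -[X in (1 + X)%R]real_normK ?num_real//.
  by have := normr_ge0 (f o); nra.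
- under eq_fun do rewrite EFinD.
  by apply: integrableD => //; exact: finite_measure_integrable_cst.
Qed.

Lemma distribution_indep d1 d2 (E1 : measurableType d1) (E2 : measurableType d2)
    (U : {mfun T >-> E1}) (V : {mfun T >-> E2}) (W : {mfun T >-> (E1 * E2)%type}) :
  (forall o, W o = (U o, V o)) ->
  (forall A B, measurable A -> measurable B ->
    P (U @^-1` A `&` V @^-1` B) = P (U @^-1` A) * P (V @^-1` B)) ->
  forall A, measurable A ->
    (distribution P U \x distribution P V) A = distribution P W A.
Proof.
move=> WE indep A mA; apply: product_measure_unique => // {mA}A B mA mB.
rewrite /= /pushforward /= -indep//; congr (P _).
by apply/seteqP; split=> o /=; rewrite WE.
Qed.

(** Independence turns the joint law into a product, so that Fubini applies with
    an independent copy of the second variable. *)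
Lemma ge0_integral_indep d1 d2 (E1 : measurableType d1) (E2 : measurableType d2)
    (U : T -> E1) (V : T -> E2) (f : E1 * E2 -> \bar R) :
  measurable_fun setT U -> measurable_fun setT V ->
  (forall A B, measurable A -> measurable B ->
    P (U @^-1` A `&` V @^-1` B) = P (U @^-1` A) * P (V @^-1` B)) ->
  measurable_fun setT f -> (forall x, 0 <= f x) ->
  \int[P]_o f (U o, V o) = \int[P]_o \int[P]_o' f (U o, V o').
Proof.
move=> /exists_mfun[U' U'E] /exists_mfun[V' V'E].
have -> : U = U' by apply/funext.
have -> : V = V' by apply/funext.
move=> indep mf f0 {U V U'E V'E}.
have [|W WE] := @exists_mfun _ _ T (E1 * E2)%type (fun o => (U' o, V' o)).
  exact: measurable_fun_pair.
transitivity (\int[distribution P W]_x f x).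
  rewrite (ge0_integral_distribution W)//.
  by apply: eq_integral => o _; rewrite /= WE.
rewrite (eq_measure_integral (distribution P U' \x distribution P V')%E); last first.
  by move=> A mA _; apply/esym/distribution_indep.
rewrite fubini_tonelli1//.
rewrite ge0_integral_distribution//; last 2 first.
  - exact: measurable_fun_fubini_tonelli_F.
  - by move=> x; apply: integral_ge0.
apply: eq_integral => o _ /=; rewrite /fubini_F ge0_integral_distribution//.
exact: measurableT_comp.
Qed.

(** Uncorrelatedness of independent variables, one of which is centered. *)
Lemma integral_mul_indep_centered (X Y : T -> R) :
  P.-integrable setT (EFin \o X) -> P.-integrable setT (EFin \o Y) ->
  (forall A B, measurable A -> measurable B ->
    P (X @^-1` A `&` Y @^-1` B) = P (X @^-1` A) * P (Y @^-1` B)) ->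
  \int[P]_o (Y o)%:E = 0 ->
  P.-integrable setT (fun o => (X o * Y o)%:E) /\
  \int[P]_o (X o * Y o)%:E = 0.
Proof.
move=> iX iY indep Y0.
have mX : measurable_fun setT X by exact/measurable_EFinP/measurable_int/iX.
have mY : measurable_fun setT Y by exact/measurable_EFinP/measurable_int/iY.
have mf : measurable_fun setT (fun z : R * R => (z.1 * z.2)%:E).
  by apply/measurable_EFinP; exact: measurable_funM.
have iXY : P.-integrable setT (fun o => (X o * Y o)%:E).
  apply/integrableP; split.
    by apply/measurable_EFinP; exact: measurable_funM.
  rewrite (ge0_integral_indep (f := fun z : R * R => `|(z.1 * z.2)%:E|))//; last first.
    exact: measurableT_comp.
  under eq_integral do under eq_integral do rewrite /= normrM EFinM.
  under eq_integral => o _.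
    rewrite ge0_integralZl//; last exact/measurable_EFinP/measurableT_comp.
  over.
  rewrite ge0_integralZr//; last 2 first.
  - exact/measurable_EFinP/measurableT_comp.
  - exact: integral_ge0.
  move/integrableP : iX => [_ iX]; move/integrableP : iY => [_ iY].
  by rewrite lte_mul_pinfty// ?integral_ge0// ge0_fin_numE ?integral_ge0.
split=> //.
have [X' X'E] := exists_mfun mX; have [Y' Y'E] := exists_mfun mY.
have XX' : X = X' by apply/funext.
have YY' : Y = Y' by apply/funext.
have [|W WE] := @exists_mfun _ _ T (R * R)%type (fun o => (X o, Y o)).
  exact: measurable_fun_pair.
transitivity (\int[distribution P W]_z (z.1 * z.2)%:E).
  rewrite (integral_distribution (X := W))//.
    by apply: eq_integral => o _; rewrite /= WE.
  by apply: eq_integrable iXY => // o _; rewrite /= WE.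
rewrite (eq_measure_integral (distribution P X' \x distribution P Y')%E); last first.
  move=> A mA _; apply/esym/distribution_indep => //.
  - by move=> o; rewrite WE XX' YY'.
  - by rewrite -XX' -YY'.
rewrite -integral12_prod_meas1.
  apply: integral0_eq => x _; rewrite /fubini_F/=.
  rewrite integral_distribution//; last 2 first.
  - by apply/measurable_EFinP; exact: measurable_funM.
  - rewrite (_ : _ \o _ = fun o => x%:E * (Y o)%:E); last first.
      by apply/funext => o; rewrite YY'.
    exact: integrableZl.
  rewrite (eq_integral (fun o => x%:E * (Y o)%:E)); last first.
    by move=> o _; rewrite YY'.
  by rewrite integralZl// Y0 mule0.
apply/integrableP; split=> //.
rewrite (eq_measure_integral (distribution P W)); last first.
  move=> A mA _; apply: distribution_indep => //.
  - by move=> o; rewrite WE XX' YY'.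
  - by rewrite -XX' -YY'.
rewrite ge0_integral_distribution//; last exact: measurableT_comp.
move/integrableP : iXY => [_]; congr (_ < _).
by apply: eq_integral => o _; rewrite /= WE.
Qed.

End IndependentIntegrals.

(** * Symmetrization *)

Section MaxNorm.
Context {R : realType} {K : eqType}.
Implicit Types (D : seq K) (a b : K -> R).

Definition max_norm D a : R := \big[Num.max/0]_(k <- D) `|a k|.

Lemma max_norm_ge0 D a : 0 <= max_norm D a.
Proof. exact: bigmax_ge_id. Qed.

Lemma le_max_norm D a k : k \in D -> `|a k| <= max_norm D a.
Proof. by move=> kD; exact: (le_bigmax_seq 0 k predT (fun k => `|a k|)). Qed.

Lemma max_norm_le D a (c : R) : 0 <= c -> (forall k, k \in D -> `|a k| <= c) ->
  max_norm D a <= c.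
Proof.
move=> c0 ac; rewrite /max_norm big_seq_cond; apply: bigmax_le => // k.
by rewrite andbT; exact: ac.
Qed.

Lemma max_normB D a b : max_norm D (fun k => a k - b k) <= max_norm D a + max_norm D b.
Proof.
apply: max_norm_le => [|k kD]; first by rewrite addr_ge0 ?max_norm_ge0.
by rewrite (le_trans (ler_normB _ _))// lerD// le_max_norm.
Qed.

Lemma measurable_max_norm D d (T : measurableType d) (a : K -> T -> R) :
  (forall k, measurable_fun setT (a k)) ->
  measurable_fun setT (fun x => max_norm D (a ^~ x)).
Proof.
move=> ma; rewrite /max_norm; elim: D => [|k D IH].
  by rewrite (_ : (fun _ => _) = cst 0)//; apply/funext => x; rewrite big_nil.
rewrite (_ : (fun _ => _) =
    (fun x => `|a k x|) \max (fun x => \big[Num.max/0]_(j <- D) `|a j x|)).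
  by apply: measurable_maxr => //; exact: measurableT_comp.
by apply/funext => x; rewrite big_cons.
Qed.

End MaxNorm.

Section IidSamples.
Context {R : realType} d (T : measurableType d) (P : probability T R).
Context d' (X : measurableType d') (n : nat).
Variables (Z : T -> X) (V : 'I_n -> T -> X).
Hypothesis mZ : measurable_fun setT Z.
Hypothesis mV : forall i, measurable_fun setT (V i).
Hypothesis same_law : forall i A, measurable A ->
  P (V i @^-1` A) = P (Z @^-1` A).
Hypothesis indep : forall A : 'I_n -> set X, (forall i, measurable (A i)) ->
  P [set o | forall i, A i (V i o)] = (\prod_(i < n) P (V i @^-1` A i))%E.
Local Open Scope ereal_scope.

Lemma ge0_integral_same_law i (f : X -> \bar R) : measurable_fun setT f ->
  (forall x, 0 <= f x) -> \int[P]_o f (V i o) = \int[P]_o f (Z o).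
Proof.
have [Z' Z'E] := exists_mfun mZ; have [V' V'E] := exists_mfun (mV i).
move=> mf f0; transitivity (\int[distribution P V']_x f x).
  rewrite ge0_integral_distribution//.
  by apply: eq_integral => o _; rewrite /= V'E.
rewrite (eq_measure_integral (distribution P Z')).
  rewrite ge0_integral_distribution//.
  by apply: eq_integral => o _; rewrite /= Z'E.
move=> A mA _; transitivity (P (V i @^-1` A)).
  by congr (P _); apply/seteqP; split=> o /=; rewrite V'E.
by rewrite same_law//; congr (P _); apply/seteqP; split=> o /=; rewrite Z'E.
Qed.

Lemma integrable_same_law i (f : X -> \bar R) : measurable_fun setT f ->
  P.-integrable setT (f \o Z) -> P.-integrable setT (f \o V i).
Proof.
move=> mf /integrableP[_ fZ]; apply/integrableP; split.
  exact: measurableT_comp.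
rewrite (@ge0_integral_same_law i (fun x => `|f x|))//.
exact: measurableT_comp.
Qed.

Lemma integral_same_law i (f : X -> \bar R) : measurable_fun setT f ->
  \int[P]_o f (V i o) = \int[P]_o f (Z o).
Proof.
move=> mf; rewrite integralE [RHS]integralE.
have mfp := measurable_funepos mf; have mfn := measurable_funeneg mf.
congr (_ - _).
  rewrite (eq_integral (fun o => f^\+ (V i o))); last first.
    by move=> o _; rewrite !funeposE.
  rewrite (ge0_integral_same_law i mfp) => [|x]; last exact: funepos_ge0.
  by apply: eq_integral => o _; rewrite !funeposE.
rewrite (eq_integral (fun o => f^\- (V i o))); last first.
  by move=> o _; rewrite !funenegE.
rewrite (ge0_integral_same_law i mfn) => [|x]; last exact: funeneg_ge0.
by apply: eq_integral => o _; rewrite !funenegE.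
Qed.

(** The pair q = (o, o') provides the sample V i o and the ghost sample V i o';
    the pattern s tells which entries of the two samples are exchanged. *)
Definition doubled (s : {ffun 'I_n -> bool}) (q : T * T) : (n + n).-tuple X :=
  [tuple match fintype.split i with
         | inl j => V j (if s j then q.2 else q.1)
         | inr j => V j (if s j then q.1 else q.2)
         end | i < n + n].

Lemma measurable_doubled s : measurable_fun setT (doubled s).
Proof.
apply/measurable_fun_tnthP => i.
rewrite (_ : _ \o _ = fun q => match fintype.split i with
         | inl j => V j (if s j then q.2 else q.1)
         | inr j => V j (if s j then q.1 else q.2)
         end); last by apply/funext => q; rewrite /= tnth_mktuple.
by case: (fintype.split i) => j; case: (s j); exact: measurableT_comp.
Qed.

(** The measure of a rectangle is the same for all exchange patterns because all
    the entries are independent with the law of Z. *)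
Lemma law_doubled s (A : 'I_(n + n) -> set X) : (forall i, measurable (A i)) ->
  (P \x P) [set q | forall i, A i (tnth (doubled s q) i)] =
  \prod_(i < n) (P (Z @^-1` A (lshift n i)) * P (Z @^-1` A (rshift n i))).
Proof.
move=> mA.
pose A1 (j : 'I_n) := if s j then A (rshift n j) else A (lshift n j).
pose A2 (j : 'I_n) := if s j then A (lshift n j) else A (rshift n j).
have mA1 j : measurable (A1 j) by rewrite /A1; case: ifP.
have mA2 j : measurable (A2 j) by rewrite /A2; case: ifP.
have mcap (B : 'I_n -> set X) : (forall i, measurable (B i)) ->
    measurable [set o | forall i, B i (V i o)].
  move=> mB; rewrite (_ : [set _ | _] = \big[setI/setT]_(i < n) (V i @^-1` B i)).
    apply: bigsetI_measurable => i _; rewrite -[X in measurable X]setTI.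
    exact: mV.
  rewrite -bigcap_seq; apply/seteqP; split=> x /= h i; first by move=> _; exact: h.
  by apply: h; rewrite /= mem_index_enum.
rewrite (_ : [set _ | _] =
    [set o | forall i, A1 i (V i o)] `*` [set o | forall i, A2 i (V i o)]).
  rewrite product_measure1E; [|exact: mcap|exact: mcap].
  transitivity ((\prod_(i < n) P (V i @^-1` A1 i)) *
                (\prod_(i < n) P (V i @^-1` A2 i))).
    by congr (_ * _); exact: indep.
  rewrite -big_split/=; apply: eq_bigr => i _.
  rewrite !same_law// /A1 /A2; case: (s i) => //; exact: muleC.
apply/seteqP; split=> [q /= h|q /= [h1 h2] i].
  split=> i.
    rewrite /A1; have := h (lshift n i); have := h (rshift n i).
    rewrite !tnth_mktuple -/(unsplit (inl i)) -/(unsplit (inr i)) !unsplitK.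
    by case: (s i).
  rewrite /A2; have := h (lshift n i); have := h (rshift n i).
  rewrite !tnth_mktuple -/(unsplit (inl i)) -/(unsplit (inr i)) !unsplitK.
  by case: (s i).
rewrite tnth_mktuple; case: splitP => j ij.
  have -> : i = lshift n j by exact/val_inj.
  by have := h1 j; have := h2 j; rewrite /A1 /A2; case: (s j).
have -> : i = rshift n j by exact/val_inj.
by have := h1 j; have := h2 j; rewrite /A1 /A2; case: (s j).
Qed.

Lemma integral_doubled s s' (f : (n + n).-tuple X -> \bar R) :
  measurable_fun setT f -> (forall x, 0 <= f x) ->
  \int[P \x P]_q f (doubled s q) = \int[P \x P]_q f (doubled s' q).
Proof.
move=> mf f0.
have [F FE] := exists_mfun (measurable_doubled s).
have [F' F'E] := exists_mfun (measurable_doubled s').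
transitivity (\int[distribution (P \x P)%E F]_x f x).
  rewrite ge0_integral_distribution//.
  by apply: eq_integral => o _; rewrite /= FE.
rewrite (eq_measure_integral (distribution (P \x P)%E F')).
  rewrite ge0_integral_distribution//.
  by apply: eq_integral => o _; rewrite /= F'E.
move=> A mA _; apply: tuple_measure_eq_rectangles => //.
  by rewrite (le_lt_trans (probability_le1 _ _))// ltry.
move=> B mB.
transitivity ((P \x P)%E [set q | forall i, B i (tnth (doubled s q) i)]).
  by congr ((P \x P)%E _); apply/seteqP; split=> q /=; rewrite FE.
rewrite law_doubled// -(law_doubled s')//.
by congr ((P \x P)%E _); apply/seteqP; split=> q /=; rewrite F'E.
Qed.

Section Symmetrization.
Hypothesis n_gt0 : (0 < n)%N.
Variables (K : eqType) (phi : K -> X -> R).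
Hypothesis mphi : forall k, measurable_fun setT (phi k).
Hypothesis iphi : forall k, P.-integrable setT (fun o => (phi k (Z o))%:E).

Let E k : R := (\int[P]_o phi k (Z o))%R.

Let iphiV k i : P.-integrable setT (fun o => (phi k (V i o))%:E).
Proof.
apply: (@integrable_same_law i (fun x => (phi k x)%:E)); last exact: iphi.
exact/measurable_EFinP.
Qed.

Let intV k i : \int[P]_o (phi k (V i o))%:E = (E k)%:E.
Proof.
rewrite (@integral_same_law i (fun x => (phi k x)%:E)); last exact/measurable_EFinP.
by rewrite /E EFin_Rintegral//; exact: iphi.
Qed.

(** Averaging over the ghost sample replaces it by the expectation. *)
Lemma integral_ghost_sample k o :
  \int[P]_o' (n%:R^-1 * \sum_i (phi k (V i o) - phi k (V i o')))%:E =
  (n%:R^-1 * \sum_i phi k (V i o) - E k)%:E.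
Proof.
have iB i : P.-integrable setT
    (fun o' => (phi k (V i o))%:E - (phi k (V i o'))%:E).
  apply: integrableB => //; exact: finite_measure_integrable_cst.
transitivity (\sum_i (n%:R^-1 * (phi k (V i o) - E k))%:E).
  under eq_integral do rewrite mulr_sumr -sumEFin.
  rewrite integral_sum//; last first.
    move=> i; rewrite (_ : (fun _ => _) = (fun o' =>
      n%:R^-1%:E * ((phi k (V i o))%:E - (phi k (V i o'))%:E))).
      exact: integrableZl.
    by apply/funext => o'; rewrite EFinM EFinB.
  apply: eq_bigr => i _.
  under eq_integral do rewrite EFinM EFinB.
  rewrite integralZl// integralB//; last exact: finite_measure_integrable_cst.
  by rewrite intV integral_cst//= probability_setT mule1 -EFinB -EFinM.
rewrite sumEFin -mulr_sumr sumrB mulrBr sumr_const card_ord -(mulr_natl (E k)).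
by rewrite mulrA mulVf ?mul1r// pnatr_eq0 -lt0n.
Qed.

(** The exchange of the i-th entries changes the sign of the i-th term of the
    gap, which is how the random signs appear. *)
Let gap (x : (n + n).-tuple X) k : R := n%:R^-1 *
  \sum_i (phi k (tnth x (lshift n i)) - phi k (tnth x (rshift n i))).

Let gapE s q k : gap (doubled s q) k = (n%:R^-1 *
  \sum_i ((-1) ^+ s i * (phi k (V i q.1) - phi k (V i q.2))))%R.
Proof.
rewrite /gap; congr (_ * _)%R; apply: eq_bigr => i _.
rewrite !tnth_mktuple -/(unsplit (inl i)) -/(unsplit (inr i)) !unsplitK.
by case: (s i); rewrite ?expr0 ?mul1r// expr1 mulN1r opprB.
Qed.

Let measurable_gap D : measurable_fun setT (fun x => (max_norm D (gap x))%:E).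
Proof.
apply/measurable_EFinP/measurable_max_norm => k; rewrite /gap.
apply: measurable_funM => //; apply: measurable_sum => i.
by apply: measurable_funB; apply: measurableT_comp => //; exact: measurable_tnth.
Qed.

(** Jensen: the norm of an average over the ghost sample is at most the average
    of the norm. *)
Lemma le_integral_max_norm_ghost D :
  \int[P]_o (max_norm D (fun k => n%:R^-1 * \sum_i phi k (V i o) - E k))%:E <=
  \int[P \x P]_q (max_norm D (gap (doubled [ffun=> false] q)))%:E.
Proof.
have mf : measurable_fun setT
    (fun q => (max_norm D (gap (doubled [ffun=> false] q)))%:E).
  exact: (measurableT_comp (measurable_gap D) (measurable_doubled _)).
rewrite fubini_tonelli1//; last by move=> q; rewrite lee_fin max_norm_ge0.
apply: ge0_le_integral => //.
- by move=> o _; rewrite lee_fin max_norm_ge0.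
- apply/measurable_EFinP/measurable_max_norm => k.
  apply: measurable_funB => //; apply: measurable_funM => //.
  by apply: measurable_sum => i; exact: measurableT_comp.
- apply: measurable_fun_fubini_tonelli_F => //.
  by move=> q; rewrite lee_fin max_norm_ge0.
move=> o _; rewrite /fubini_F.
have mo : measurable_fun setT
    (fun o' => (max_norm D (gap (doubled [ffun=> false] (o, o'))))%:E).
  exact: (measurableT_comp mf (pair1_measurable o)).
have I0 : 0 <= \int[P]_o' (max_norm D (gap (doubled [ffun=> false] (o, o'))))%:E.
  by apply: integral_ge0 => o' _; rewrite lee_fin max_norm_ge0.
case: (eqVneq (\int[P]_o' (max_norm D (gap (doubled [ffun=> false] (o, o'))))%:E) +oo)
  => [->|Ioo]; first by rewrite leey.
rewrite -[leRHS]fineK; last by rewrite ge0_fin_numE// lt_neqAle Ioo leey.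
rewrite lee_fin; apply: max_norm_le => [|k kD]; first exact: fine_ge0.
rewrite -lee_fin fineK; last by rewrite ge0_fin_numE// lt_neqAle Ioo leey.
rewrite -abse_EFin -integral_ghost_sample (le_trans (le_abse_integral _ _ _))//.
  apply/measurable_EFinP/measurable_funM => //; apply: measurable_sum => i.
  by apply: measurable_funB => //; exact: measurableT_comp.
apply: ge0_le_integral => //.
- apply: measurableT_comp => //.
  apply/measurable_EFinP/measurable_funM => //; apply: measurable_sum => i.
  by apply: measurable_funB => //; exact: measurableT_comp.
- move=> o' _; rewrite lee_fin.
  rewrite (le_trans _ (le_max_norm _ kD))// gapE/=.
  by under [in leRHS]eq_bigr do rewrite ffunE expr0 mul1r.
Qed.

(** All exchange patterns give the gap the same expectation, so that it may be
    averaged over the patterns; that average is bounded pointwise by the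
    Rademacher averages of the sample and of the ghost sample. *)
Lemma symmetrization (D : seq K) (Xi : set X) (rho : R) :
  (0 <= rho)%R -> {ae P, forall o, forall i, Xi (V i o)} ->
  (forall z : 'I_n -> X, (forall i, Xi (z i)) ->
    2 ^- n * \sum_(s : {ffun 'I_n -> bool})
      max_norm D (fun k => n%:R^-1 * \sum_i (-1) ^+ s i * phi k (z i)) <= rho)%R ->
  \int[P]_o (max_norm D (fun k => n%:R^-1 * \sum_i phi k (V i o) - E k))%:E <=
  (2 * rho)%:E.
Proof.
move=> rho0 [B [mB PB BXi]] rad.
apply: (le_trans (le_integral_max_norm_ghost D)).
set I := integral _ _ _.
have mgap s : measurable_fun setT (fun q => (max_norm D (gap (doubled s q)))%:E).
  exact: (measurableT_comp (measurable_gap D) (measurable_doubled _)).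
have IE : I = \int[P \x P]_q ((2 ^- n)%:E *
    \sum_(s : {ffun 'I_n -> bool}) (max_norm D (gap (doubled s q)))%:E).
  rewrite ge0_integralZl//; first last.
  - by move=> q _; apply: sume_ge0 => s _; rewrite lee_fin max_norm_ge0.
  - exact: emeasurable_sum.
  rewrite ge0_integral_sum//; last by move=> s q _; rewrite lee_fin max_norm_ge0.
  rewrite (eq_bigr (fun=> I)); last first.
    move=> s _; apply: (@integral_doubled s _ (fun x => (max_norm D (gap x))%:E)) => //.
    by move=> x; rewrite lee_fin max_norm_ge0.
  under eq_bigr do rewrite -[I]mul1e.
  rewrite -ge0_sume_distrl// sumEFin muleA -EFinM sumr_const card_ffun.
  by rewrite card_bool card_ord natrX mulVf ?mul1e// expf_neq0// pnatr_eq0.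
rewrite IE -[leRHS]mule1 -(probability_setT (P \x P)%E) -integral_cst//.
have c0 : 0 <= (2 ^- n)%:E :> \bar R by rewrite lee_fin invr_ge0 exprn_ge0.
apply: ae_ge0_le_integral => //.
- move=> q _; rewrite mule_ge0//.
  by apply: sume_ge0 => s _; rewrite lee_fin max_norm_ge0.
- by apply: measurable_funeM; exact: emeasurable_sum.
- by move=> q _ /=; rewrite lee_fin mulr_ge0.
have BXiP o : ~ B o -> forall i, Xi (V i o).
  by move=> nB; apply: contrapT => h; apply/nB/BXi.
exists (B `*` setT `|` setT `*` B); split.
- by apply: measurableU; exact: measurableX.
- rewrite measureU0; [|exact: measurableX|exact: measurableX|].
    by rewrite [LHS]product_measure1E// [X in X * _]PB mul0e.
  by rewrite [LHS]product_measure1E// [X in _ * X]PB mule0.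
move=> q /= nle; apply: contrapT => nB; apply: nle => _.
have B1 : forall i, Xi (V i q.1) by apply: BXiP => Bq; apply: nB; left.
have B2 : forall i, Xi (V i q.2) by apply: BXiP => Bq; apply: nB; right.
rewrite sumEFin -EFinM lee_fin mulr_natl mulr2n.
apply: le_trans (lerD (rad _ B1) (rad _ B2)).
rewrite -mulrDr ler_wpM2l ?invr_ge0 ?exprn_ge0// -big_split/=.
apply: ler_sum => s _; apply: le_trans (max_normB _ _ _).
rewrite le_eqVlt; apply/orP; left; apply/eqP; congr (max_norm D _).
apply/funext => k; rewrite gapE -mulrBr -sumrB; congr (_ * _)%R.
by apply: eq_bigr => i _; rewrite mulrBr.
Qed.

End Symmetrization.

(** * Variance of an average that depends on the past *)

Lemma pair_indep i j (A B : set X) : i != j -> measurable A -> measurable B ->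
  P (V i @^-1` A `&` V j @^-1` B) = P (V i @^-1` A) * P (V j @^-1` B).
Proof.
move=> ij mA mB.
pose C k := if k == i then A else if k == j then B else setT.
have mC k : measurable (C k) by rewrite /C; do 2 case: ifP => //.
have := indep mC; rewrite (bigD1 i)//= (bigD1 j)/=; last by rewrite eq_sym.
rewrite big1 => [|k /andP[/negPf ki /negPf kj]]; last first.
  by rewrite /C ki kj preimage_setT probability_setT.
rewrite mule1 /C !eqxx [in X in _ * X]ifN 1?eq_sym// => <-; congr (P _).
apply/seteqP; split=> [t /= [At Bt] k|t /= h].
  by case: eqP => [->//|_]; case: eqP => [->|].
by split; [have := h i|have := h j]; rewrite eqxx// eq_sym (negPf ij).
Qed.

(** Distinct terms are uncorrelated, and a variance is at most a second moment. *)
Lemma variance_mean (psi : X -> R) : (0 < n)%N -> measurable_fun setT psi ->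
  P.-integrable setT (fun o => (psi (Z o) ^+ 2)%:E) ->
  \int[P]_o ((n%:R^-1 * \sum_i psi (V i o) - \int[P]_o' psi (Z o')) ^+ 2)%:E <=
  n%:R^-1%:E * \int[P]_o (psi (Z o) ^+ 2)%:E.
Proof.
move=> n0 mpsi psi2.
have mpsiZ : measurable_fun setT (fun o => psi (Z o)) by exact: measurableT_comp.
have ipsi := integrable_of_sqr mpsiZ psi2.
set c : R := (\int[P]_o' psi (Z o'))%R.
have cE : c%:E = \int[P]_o (psi (Z o))%:E by exact: EFin_Rintegral.
pose xi i o : R := (psi (V i o) - c)%R.
have ipsiV i : P.-integrable setT (fun o => (psi (V i o))%:E).
  apply: (@integrable_same_law i (fun x => (psi x)%:E)); last exact: ipsi.
  exact/measurable_EFinP.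
have ipsi2V i : P.-integrable setT (fun o => (psi (V i o) ^+ 2)%:E).
  apply: (@integrable_same_law i (fun x => (psi x ^+ 2)%:E)); last exact: psi2.
  by apply/measurable_EFinP; exact: measurable_funX.
have ixi i : P.-integrable setT (EFin \o xi i).
  rewrite (_ : _ \o _ = fun o => (psi (V i o))%:E - c%:E).
    by apply: integrableB => //; exact: finite_measure_integrable_cst.
  by apply/funext => o; rewrite /= EFinB.
have xi0 i : \int[P]_o (xi i o)%:E = 0.
  rewrite /xi; under eq_integral do rewrite EFinB.
  rewrite integralB//; last exact: finite_measure_integrable_cst.
  rewrite (@integral_same_law i (fun x => (psi x)%:E)); last exact/measurable_EFinP.
  by rewrite -cE integral_cst//= probability_setT mule1 subee.
have xi2E i o : (xi i o * xi i o)%:E =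
    (psi (V i o) ^+ 2)%:E - (2 * c)%:E * (psi (V i o))%:E + (c ^+ 2)%:E.
  by rewrite -EFinM -EFinB -EFinD /xi; congr EFin; ring.
have ic i : P.-integrable setT
    (fun o => (psi (V i o) ^+ 2)%:E - (2 * c)%:E * (psi (V i o))%:E).
  by apply: integrableB => //; exact: integrableZl.
have ixx i j : P.-integrable setT (fun o => (xi i o * xi j o)%:E) /\
    \int[P]_o (xi i o * xi j o)%:E <=
      (if i == j then \int[P]_o (psi (Z o) ^+ 2)%:E else 0).
  have [<-|ij] := eqVneq i j.
    split.
      rewrite (_ : (fun _ => _) = (fun o => ((psi (V i o) ^+ 2)%:E
          - (2 * c)%:E * (psi (V i o))%:E) + (c ^+ 2)%:E)).
        by apply: integrableD => //; exact: finite_measure_integrable_cst.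
      by apply/funext => o; rewrite xi2E.
    under eq_integral do rewrite xi2E.
    rewrite integralD//; last exact: finite_measure_integrable_cst.
    rewrite integralB//; last exact: integrableZl.
    rewrite integralZl// integral_cst//= probability_setT mule1.
    rewrite (@integral_same_law i (fun x => (psi x)%:E)); last exact/measurable_EFinP.
    rewrite (@integral_same_law i (fun x => (psi x ^+ 2)%:E)); last first.
      by apply/measurable_EFinP; exact: measurable_funX.
    rewrite -cE -EFinM -addeA -EFinN -EFinD -[leRHS]adde0 leeD2l// lee_fin.
    by have := sqr_ge0 c; rewrite expr2; nra.
  have [||||ixixj ->] := @integral_mul_indep_centered _ _ _ P (xi i) (xi j) => //.
  move=> A B mA mB.
  have mxi : measurable_fun setT (fun x => psi x - c)%R.
    exact: measurable_funB.
  have := @pair_indep i j ((fun x => psi x - c)%R @^-1` A)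
    ((fun x => psi x - c)%R @^-1` B) ij.
  apply; rewrite -[X in measurable X]setTI; exact: mxi.
have E o : ((n%:R^-1 * \sum_i psi (V i o) - c) ^+ 2)%:E =
    (n%:R^-1 ^+ 2)%:E * \sum_i \sum_j (xi i o * xi j o)%:E.
  rewrite (eq_bigr (fun i => (xi i o * \sum_j xi j o)%:E)); last first.
    by move=> i _; rewrite sumEFin mulr_sumr.
  rewrite sumEFin -EFinM; congr EFin.
  rewrite -mulr_suml -expr2 -exprMn; congr (_ ^+ 2)%R.
  rewrite sumrB mulrBr sumr_const card_ord -(mulr_natl c) mulrA mulVf ?mul1r//.
  by rewrite pnatr_eq0 -lt0n.
under eq_integral do rewrite E.
have isum i : P.-integrable setT (fun o => \sum_j (xi i o * xi j o)%:E).
  by apply: integrable_sum => // j _; have [] := ixx i j.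
rewrite integralZl//; last by apply: integrable_sum.
rewrite integral_sum//.
under eq_bigr => i _.
  rewrite integral_sum//; last by move=> j; have [] := ixx i j.
  over.
rewrite expr2 EFinM -muleA lee_wpmul2l ?lee_fin ?invr_ge0//.
apply: (@le_trans _ _ (n%:R^-1%:E * \sum_(i < n) \int[P]_o (psi (Z o) ^+ 2)%:E)).
  rewrite lee_wpmul2l ?lee_fin ?invr_ge0//; apply: lee_sum => i _.
  apply: (le_trans (lee_sum _ (fun j _ => (ixx i j).2))).
  by rewrite -big_mkcond/= (big_pred1 i)// => j; rewrite /= eq_sym.
set I := integral _ _ _.
under eq_bigr do rewrite -[I]mul1e.
rewrite -ge0_sume_distrl// sumEFin sumr_const card_ord muleA -EFinM mulVf ?mul1e//.
by rewrite pnatr_eq0 -lt0n.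
Qed.

(** The parameter W is independent of the sample as a whole; conditionally on W
    the average is one of independent identically distributed terms. *)
Section ParametricVariance.
Context de (E : measurableType de) (W : T -> E).
Hypothesis mW : measurable_fun setT W.
Hypothesis indepW : forall (A : set E) (B : 'I_n -> set X), measurable A ->
  (forall i, measurable (B i)) ->
  P (W @^-1` A `&` [set o | forall i, B i (V i o)]) =
  P (W @^-1` A) * \prod_(i < n) P (V i @^-1` B i).

Let sample (o : T) : n.-tuple X := [tuple V i o | i < n].

Let measurable_sample : measurable_fun setT sample.
Proof.
apply/measurable_fun_tnthP => i; rewrite (_ : _ \o _ = V i)//.
by apply/funext => o; rewrite /= tnth_mktuple.
Qed.

Let indep_sample (A : set E) (B : set (n.-tuple X)) : measurable A ->
  measurable B ->
  P (W @^-1` A `&` sample @^-1` B) = P (W @^-1` A) * P (sample @^-1` B).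
Proof.
move=> mA mB.
have mWA : measurable (W @^-1` A) by rewrite -[X in measurable X]setTI; exact: mW.
have [F FE] := exists_mfun measurable_sample.
have -> : sample = F by apply/funext.
pose p : {nonneg R} := NngNum (fine_ge0 (measure_ge0 P (W @^-1` A))).
have pE : p%:num%:E = P (W @^-1` A) by rewrite /= fineK// fin_num_measure.
transitivity (pushforward (mrestr P mWA) F B).
  by rewrite /pushforward /mrestr setIC.
rewrite -pE; transitivity (mscale p (distribution P F) B); last by [].
(* For fixed A, both sides are finite measures of B. *)
apply: tuple_measure_eq_rectangles => //.
  rewrite [X in X < _]/= /pushforward /mrestr /=.
  by rewrite (le_lt_trans (probability_le1 _ _))// ?ltry// setTI.
move=> C mC; rewrite [LHS]/= [RHS]/= /pushforward /mrestr /mscale/= pE.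
have CE : F @^-1` [set x | forall i, C i (tnth x i)] =
    [set o | forall i, C i (V i o)].
  by apply/seteqP; split=> t /= h i; have := h i; rewrite FE tnth_mktuple.
by rewrite CE setIC indepW// -(indep mC) /distribution/pushforward CE.
Qed.

Lemma measurable_fun_Rintegral (phi : E -> X -> R) :
  measurable_fun setT (fun p : E * X => phi p.1 p.2) ->
  measurable_fun setT (fun e => \int[P]_o phi e (Z o))%R.
Proof.
move=> mphi; rewrite /Rintegral.
have mq : measurable_fun setT (fun q : E * T => (phi q.1 (Z q.2))%:E).
  have mEZ : measurable_fun setT (fun q : E * T => (q.1, Z q.2)).
    by apply: measurable_fun_pair => //; exact: measurableT_comp.
  by apply/measurable_EFinP; have := measurableT_comp mphi mEZ; exact.
apply: measurableT_comp => //.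
under eq_fun do rewrite integralE.
apply: emeasurable_funB.
- rewrite (_ : (fun _ => _) =
      fubini_F P (fun q : E * T => (phi q.1 (Z q.2))%:E)^\+).
    by apply: measurable_fun_fubini_tonelli_F => //; exact: measurable_funepos.
  by apply/funext => e; apply: eq_integral => o _; rewrite !funeposE.
- rewrite (_ : (fun _ => _) =
      fubini_F P (fun q : E * T => (phi q.1 (Z q.2))%:E)^\-).
    by apply: measurable_fun_fubini_tonelli_F => //; exact: measurable_funeneg.
  by apply/funext => e; apply: eq_integral => o _; rewrite !funenegE.
Qed.

Lemma parametric_variance_mean (phi : E -> X -> R) (b : X -> R) : (0 < n)%N ->
  measurable_fun setT (fun p : E * X => phi p.1 p.2) ->
  measurable_fun setT b -> (forall e x, `|phi e x| <= b x)%R ->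
  P.-integrable setT (fun o => (b (Z o) ^+ 2)%:E) ->
  \int[P]_o ((n%:R^-1 * \sum_i phi (W o) (V i o) -
      \int[P]_o' phi (W o) (Z o')) ^+ 2)%:E <=
  n%:R^-1%:E * \int[P]_o (b (Z o) ^+ 2)%:E.
Proof.
move=> n0 mphi mb phib b2.
pose f (p : E * n.-tuple X) : \bar R := ((n%:R^-1 * \sum_i phi p.1 (tnth p.2 i) -
      \int[P]_o' phi p.1 (Z o')) ^+ 2)%:E.
have mf : measurable_fun setT f.
  apply/measurable_EFinP; apply: measurable_funX; apply: measurable_funB.
    apply: measurable_funM => //; apply: measurable_sum => i.
    have mEi : measurable_fun setT (fun p : E * n.-tuple X => (p.1, tnth p.2 i)).
      apply: measurable_fun_pair => //.
      exact: (measurableT_comp (measurable_tnth i)).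
    exact: (measurableT_comp mphi mEi).
  by apply: (measurableT_comp (measurable_fun_Rintegral mphi)).
have fE o o' : f (W o, sample o') =
    ((n%:R^-1 * \sum_i phi (W o) (V i o') -
      \int[P]_o' phi (W o) (Z o')) ^+ 2)%:E.
  rewrite /f /=; congr ((_ * _ - _) ^+ 2)%:E.
  by apply: eq_bigr => i _; rewrite tnth_mktuple.
have f0 p : 0 <= f p by rewrite lee_fin sqr_ge0.
under eq_integral do rewrite -fE.
rewrite (ge0_integral_indep mW measurable_sample)//.
rewrite -[leRHS]mule1 -(probability_setT P) -integral_cst//.
have mphi1 e : measurable_fun setT (phi e).
  exact: (measurableT_comp mphi (pair1_measurable e)).
apply: ge0_le_integral => //.
- by move=> o _; exact: integral_ge0.
- have mEs : measurable_fun setT (fun q : E * T => (q.1, sample q.2)).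
    by apply: measurable_fun_pair => //; exact: measurableT_comp.
  have mfs := measurableT_comp mf mEs.
  have := measurable_fun_fubini_tonelli_F (m2 := P) _ mfs (fun q => f0 _).
  by move=> mF; exact: (measurableT_comp mF mW).
move=> o _ /=; under eq_integral do rewrite fE.
have mphiZ : measurable_fun setT (fun o' => (phi (W o) (Z o') ^+ 2)%:E).
  by apply/measurable_EFinP/measurable_funX; exact: measurableT_comp.
have phi2 x : (phi (W o) x ^+ 2 <= b x ^+ 2)%R.
  rewrite -[leLHS]real_normK ?num_real// lerXn2r ?nnegrE//.
  exact: le_trans (phib (W o) x).
apply: (le_trans (variance_mean n0 (mphi1 _) _)).
  apply: le_integrable b2 => // o' _ /=.
  by rewrite lee_fin !ger0_norm ?sqr_ge0.
rewrite lee_wpmul2l ?lee_fin ?invr_ge0//.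
apply: ge0_le_integral => //.
- by move=> o' _; rewrite lee_fin sqr_ge0.
- by apply/measurable_EFinP/measurable_funX; exact: measurableT_comp.
- by move=> o' _; rewrite lee_fin.
Qed.
End ParametricVariance.

End IidSamples.

(** * Borel sets of vectors and almost sure summability *)

Section BorelVectors.
Context {R : realType}.

Lemma open_measurable_mx m n (A : set 'M[R]_(m, n)) : open A -> measurable A.
Proof. exact: sub_sigma_algebra. Qed.

Lemma compact_measurable_mx m n (A : set 'M[R]_(m, n)) :
  compact A -> measurable A.
Proof.
move=> kA; rewrite -(setCK A); apply: measurableC.
apply: open_measurable_mx; apply: closed_openC; apply: compact_closed kA.
exact: norm_hausdorff.
Qed.

Lemma lower_semicontinuous_measurable_mx m n (f : 'M[R]_(m, n) -> \bar R) :
  lower_semicontinuous f -> measurable_fun setT f.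
Proof.
move=> scf; apply: (measurability _ (ErealGenOInfty.measurableE R)).
move=> /= _ [_ [a ->]] <-; apply: measurableI => //.
apply: open_measurable_mx.
by rewrite preimage_itvoy; move/lower_semicontinuousP : scf; exact.
Qed.

Lemma continuous_measurable_mx m n (f : 'M[R]_(m, n) -> R) :
  continuous f -> measurable_fun setT f.
Proof.
move=> cf; apply: (measurability _ (RGenOpens.measurableE R)).
move=> _ [_ [a [b ->] <-]]; apply: measurableI => //.
apply: open_measurable_mx; move/continuousP : cf; apply; exact: interval_open.
Qed.

End BorelVectors.

Section Series.
Context {R : realType}.
Local Open Scope ereal_scope.

Lemma nneseries_lty_fin (f : (\bar R)^nat) : (forall k, 0 <= f k) ->
  \sum_(0 <= k <oo) f k < +oo -> forall k, f k = (fine (f k))%:E.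
Proof.
move=> f0 foo k; rewrite fineK// ge0_fin_numE// (le_lt_trans _ foo)//.
apply: le_trans (nneseries_lim_ge k.+1 _) => //.
by rewrite big_nat_recr//= leeDr// sume_ge0.
Qed.

Lemma nneseries_le_bound (f : R^nat) (M : R) : (forall k, 0 <= f k)%R ->
  (forall n, \sum_(0 <= k < n) f k <= M)%R ->
  \sum_(0 <= k <oo) (f k)%:E < +oo.
Proof.
move=> f0 fM; apply: (@le_lt_trans _ _ M%:E); last exact: ltry.
apply: lime_le; first by apply: is_cvg_nneseries => n _ _; rewrite lee_fin.
by apply: nearW => n; rewrite sumEFin lee_fin.
Qed.

Lemma nneseries_tail1 (f : (\bar R)^nat) : (forall k, 0 <= f k) ->
  f 0%N < +oo ->
  (\sum_(0 <= k <oo) f k < +oo) = (\sum_(1 <= k <oo) f k < +oo).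
Proof.
move=> f0 f0oo; rewrite nneseries_recl//.
have : f 0%N \is a fin_num by rewrite ge0_fin_numE.
move: (f 0%N) (\sum_(1 <= k <oo) f k) => [r| |] // [y| |] // _.
by rewrite -EFinD !ltry.
Qed.

(** A nonnegative series with a finite expectation is almost surely finite. *)
Lemma ae_summable d (T : measurableType d) (P : probability T R)
    (X : nat -> T -> \bar R) (C : R) (u : R^nat) :
  (forall k, measurable_fun setT (X k)) -> (forall k o, 0 <= X k o) ->
  (forall k, 0 <= u k)%R -> (0 <= C)%R ->
  (forall k, \int[P]_o X k o <= (C * u k)%:E) ->
  \sum_(0 <= k <oo) (u k)%:E < +oo ->
  {ae P, forall o, \sum_(0 <= k <oo) X k o < +oo}.
Proof.
move=> mX X0 u0 C0 XC uoo.
have mS : measurable_fun setT (fun o => \sum_(0 <= k <oo) X k o).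
  exact: ge0_emeasurable_sum.
have S0 o : 0 <= \sum_(0 <= k <oo) X k o by exact: nneseries_ge0.
suff /integrable_ae : P.-integrable setT (fun o => \sum_(0 <= k <oo) X k o).
  move=> /(_ measurableT); apply: filterS => o /(_ I).
  by rewrite ge0_fin_numE.
apply/integrableP; split=> //.
under eq_integral do rewrite gee0_abs//.
rewrite integral_nneseries//.
apply: (@le_lt_trans _ _ (\sum_(0 <= k <oo) C%:E * (u k)%:E)).
  by apply: lee_nneseries => *; [exact: integral_ge0|rewrite -EFinM].
rewrite nneseriesZl//; last by move=> k _; rewrite lee_fin.
rewrite lte_mul_pinfty ?lee_fin//.
Qed.

End Series.

(** * Deterministic descent with summable errors *)

Section PerturbedDescent.
Context {R : realType}.
Variables (a b x : R^nat) (c K : R).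
Hypothesis c_gt0 : 0 < c.
Hypothesis b_ge0 : forall k, 0 <= b k.
Hypothesis x_ge0 : forall k, 0 <= x k.
Hypothesis a_bound : forall k, `|a k| <= K.
Hypothesis descent : forall k, a k.+1 <= a k - c * b k + x k.
Hypothesis x_summable : (\sum_(0 <= k <oo) (x k)%:E < +oo)%E.

Let S : R := fine (\sum_(0 <= k <oo) (x k)%:E)%E.

Let sum_le n : \sum_(0 <= k < n) x k <= S.
Proof.
rewrite -lee_fin /S fineK; last first.
  by rewrite ge0_fin_numE// nneseries_ge0// => k _ _; rewrite lee_fin.
by rewrite -sumEFin; apply: nneseries_lim_ge => k _ _; rewrite lee_fin.
Qed.

Lemma perturbed_descent_summable : (\sum_(0 <= k <oo) (b k)%:E < +oo)%E.
Proof.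
apply: (@nneseries_le_bound _ _ ((K + K + S) / c)) => // n.
rewrite ler_pdivlMr// mulr_suml.
have : \sum_(0 <= k < n) (b k * c) <= a 0%N - a n + \sum_(0 <= k < n) x k.
  elim: n => [|n IH]; first by rewrite !big_geq// subrr addr0.
  by rewrite !big_nat_recr//=; have := descent n; lra.
move=> /le_trans; apply; apply: lerD; last exact: sum_le.
have := a_bound 0%N; have := a_bound n; rewrite !ler_norml; lra.
Qed.

(** Subtracting the partial sums of the errors from a gives a nonincreasing
    bounded sequence. *)
Lemma perturbed_descent_cvg : cvgn a.
Proof.
pose s n := \sum_(0 <= k < n) x k.
have cs : cvgn s.
  apply: nondecreasing_is_cvgn.
    apply/nondecreasing_seqP => n.
    by rewrite /s big_nat_recr//= lerDl.
  by exists S => _ [n _ <-]; exact: sum_le.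
have cu : cvgn (fun n => a n - s n).
  apply: nonincreasing_is_cvgn.
    apply/nonincreasing_seqP => n.
    rewrite /s big_nat_recr//=; have := descent n.
    by have := mulr_ge0 (ltW c_gt0) (b_ge0 n); lra.
  exists (- K - S) => _ [n _ <-]; have := sum_le n; have := a_bound n.
  by rewrite ler_norml /s; lra.
rewrite (_ : a = (fun n => (a n - s n) + s n)); last first.
  by apply/funext => n; rewrite subrK.
exact: is_cvgD.
Qed.

End PerturbedDescent.

(** * Euclidean structure and strong convexity *)

Section DotProduct.
Context {R : realType} {m : nat}.
Implicit Types x y z : 'rV[R]_m.

Lemma dotvDl x y z : dotv (x + y) z = dotv x z + dotv y z.
Proof. by rewrite /dotv -big_split; apply: eq_bigr => i _; rewrite mxE mulrDl. Qed.

Lemma dotvZl (a : R) x z : dotv (a *: x) z = a * dotv x z.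
Proof. by rewrite /dotv mulr_sumr; apply: eq_bigr => i _; rewrite mxE mulrA. Qed.

Lemma dotvC x y : dotv x y = dotv y x.
Proof. by apply: eq_bigr => i _; rewrite mulrC. Qed.

Lemma dotvNl x z : dotv (- x) z = - dotv x z.
Proof. by rewrite -scaleN1r dotvZl mulN1r. Qed.

Lemma dotvBl x y z : dotv (x - y) z = dotv x z - dotv y z.
Proof. by rewrite dotvDl dotvNl. Qed.

Lemma dotvBr x y z : dotv z (x - y) = dotv z x - dotv z y.
Proof. by rewrite ![dotv z _]dotvC dotvBl. Qed.

Lemma dotv_ge0 x : 0 <= dotv x x.
Proof. by apply: sumr_ge0 => i _; rewrite -expr2 sqr_ge0. Qed.

Lemma enorm_sqr x : enorm x ^+ 2 = dotv x x.
Proof. by rewrite /enorm sqr_sqrtr// dotv_ge0. Qed.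

Lemma dotv_young x y (c : R) : 0 < c ->
  dotv x y <= dotv x x / (4 * c) + c * dotv y y.
Proof.
move=> c0; rewrite /dotv mulr_suml mulr_sumr -big_split/=; apply: ler_sum => i _.
rewrite -subr_ge0 (_ : _ - _ = (x ord0 i / 2 - c * y ord0 i) ^+ 2 / c).
  by rewrite divr_ge0 ?sqr_ge0// ltW.
by field; rewrite gt_eqF.
Qed.

Lemma coord_sqr_le x i : x ord0 i ^+ 2 <= dotv x x.
Proof.
rewrite /dotv (bigD1 i)//= -expr2 lerDl sumr_ge0// => j _.
by rewrite -expr2 sqr_ge0.
Qed.

Lemma coord_norm_le x i : `|x ord0 i| <= enorm x.
Proof.
rewrite -(@ler_pXn2r _ 2)// ?nnegrE ?sqrtr_ge0// enorm_sqr real_normK ?num_real//.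
exact: coord_sqr_le.
Qed.

Lemma mx_norm_le_enorm x : `|x| <= enorm x.
Proof.
rewrite [leLHS]/Num.norm /= mx_normrE; apply: bigmax_le => [|[i j] _].
  exact: sqrtr_ge0.
by rewrite [i]ord1 coord_norm_le.
Qed.

(** The defect of convexity of the squared norm, source of all quadratic gains. *)
Lemma dotv_convex x y (t : R) :
  dotv (t *: x + (1 - t) *: y) (t *: x + (1 - t) *: y) =
  t * dotv x x + (1 - t) * dotv y y - t * (1 - t) * dotv (x - y) (x - y).
Proof.
rewrite !(dotvDl, dotvBl, dotvZl, dotvNl) ![dotv _ (_ + _)]dotvC.
rewrite !(dotvDl, dotvBl, dotvZl, dotvNl).
by rewrite (dotvC y x); ring.
Qed.

Lemma cvg_dotv (u v : nat -> 'rV[R]_m) a b :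
  u @ \oo --> a -> v @ \oo --> b ->
  (fun k => dotv (u k) (v k)) @ \oo --> dotv a b.
Proof.
move=> ua vb; rewrite /dotv; apply: cvg_big => [|i _]; first exact: add_continuous.
apply: cvgM.
  exact: (cvg_comp _ _ ua (@coord_continuous R 1 m ord0 i a)).
exact: (cvg_comp _ _ vb (@coord_continuous R 1 m ord0 i b)).
Qed.

Lemma enorm_cvg0 (u : nat -> 'rV[R]_m) :
  (fun k => enorm (u k) ^+ 2) @ \oo --> (0 : R) -> u @ \oo --> (0 : 'rV[R]_m).
Proof.
move=> u0; apply/cvgrPdist_lt => e e0.
move/cvgrPdist_lt : u0 => /(_ (e ^+ 2)); rewrite exprn_gt0// => /(_ isT).
apply: filterS => k; rewrite !sub0r !normrN => h.
apply: (le_lt_trans (mx_norm_le_enorm _)).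
rewrite -(@ltr_pXn2r _ 2)// ?nnegrE ?sqrtr_ge0 ?ltW//.
exact: le_lt_trans (ler_norm _) h.
Qed.

End DotProduct.

Section StrongConvexity.
Context {R : realType} {m : nat}.
Implicit Types f : 'rV[R]_m -> \bar R.

Lemma econvex_real f (S : set 'rV[R]_m) (phi : 'rV[R]_m -> R) :
  econvex f -> (forall x, S x -> f x = (phi x)%:E) ->
  forall x y (t : R), S x -> S y -> S (t *: x + (1 - t) *: y) -> 0 <= t <= 1 ->
  phi (t *: x + (1 - t) *: y) <= t * phi x + (1 - t) * phi y.
Proof.
move=> cf fE x y t Sx Sy Sxy t01; have := cf x y t t01.
by rewrite !fE// -!EFinM -EFinD lee_fin.
Qed.

(** Since mu is below the supremum, there is an admissible modulus nu > mu, and the defect of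
    convexity of nu / 2 |.|^2 at a midpoint is nu / 8 |y - x|^2.  The midpoint
    alone already improves a subgradient inequality by a quadratic term, without
    a limit along the segment. *)
Lemma strong_convexity_midpoint f (S : set 'rV[R]_m) (phi : 'rV[R]_m -> R)
    (mu : R) :
  (mu%:E < strong_convexity_modulus f)%E -> 0 <= mu ->
  (forall x, S x -> f x = (phi x)%:E) ->
  forall x y, S x -> S y -> S (2^-1 *: x + 2^-1 *: y) ->
  phi (2^-1 *: x + 2^-1 *: y) <=
    (phi x + phi y) / 2 - mu / 8 * enorm (y - x) ^+ 2.
Proof.
move=> /ereal_sup_gt[_ [nu [nu0 cvx] <-]]; rewrite lte_fin => munu mu0 fE x y Sx Sy Sxy.
have half : 1 - 2^-1 = 2^-1 :> R by field.
have h01 : (0 <= 2^-1 :> R) && (2^-1 <= 1 :> R) by apply/andP; split; lra.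
have := cvx x y 2^-1 h01; rewrite half !fE//.
rewrite -!EFinB -!EFinM -EFinD lee_fin !enorm_sqr.
have := dotv_convex x y 2^-1; rewrite half => ->.
have -> : dotv (y - x) (y - x) = dotv (x - y) (x - y).
  by rewrite -opprB dotvNl dotvC dotvNl opprK.
have : 0 <= (nu - mu) * dotv (x - y) (x - y).
  by rewrite mulr_ge0 ?dotv_ge0// subr_ge0 ltW.
lra.
Qed.

End StrongConvexity.

(** * One step of the algorithm *)

Section DescentStep.
Context {R : realType} {m : nat}.
Variables (S : set 'rV[R]_m) (G H Gk : 'rV[R]_m -> R) (cG cH D : R).
Variables (t tb x y : 'rV[R]_m).
Hypothesis Sx : S x.
Hypothesis Sy : S y.
Hypothesis Smid : S (2^-1 *: x + 2^-1 *: y).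
Hypothesis c_gt0 : 0 < cG + cH.
Hypothesis y_min : forall v, S v -> Gk y - dotv t y <= Gk v - dotv t v.
Hypothesis tb_sub : forall v, S v -> H x + dotv (v - x) tb <= H v.
Hypothesis Gk_mid : Gk (2^-1 *: x + 2^-1 *: y) <=
  (Gk x + Gk y) / 2 - cG * enorm (y - x) ^+ 2.
Hypothesis H_mid : H (2^-1 *: x + 2^-1 *: y) <=
  (H x + H y) / 2 - cH * enorm (y - x) ^+ 2.
Hypothesis dev : forall v, S v -> `|Gk v - G v| <= D.

(** At the midpoint of x and y, the minimality of y for Gk - t and the subgradient
    tb of H at x each gain twice their quadratic surplus.  Half of the gain
    absorbs the term <t - tb, y - x> by Young's inequality. *)
Lemma dca_descent_step :
  G y - H y <= G x - H x - (cG + cH) * enorm (y - x) ^+ 2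
    + (2 * D + enorm (t - tb) ^+ 2 / (4 * (cG + cH))).
Proof.
have := dev Sx; have := dev Sy; rewrite !ler_norml => /andP[dy1 dy2] /andP[dx1 dx2].
have := y_min Smid; have := tb_sub Smid.
have -> : 2^-1 *: x + 2^-1 *: y - x = 2^-1 *: (y - x).
  rewrite scalerBr -[X in _ - X]scale1r addrAC -scalerBl addrC.
  by rewrite (_ : 2^-1 - 1 = - 2^-1) ?scaleNr//; field.
rewrite dotvZl dotvBl (dotvC t (_ + _)) dotvDl !dotvZl (dotvC t y).
have := dotv_young (t - tb) (y - x) c_gt0.
have -> : dotv (t - tb) (y - x) =
    dotv y t - dotv x t - (dotv y tb - dotv x tb).
  by rewrite dotvC dotvBr !dotvBl.
move: Gk_mid H_mid; rewrite !enorm_sqr.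
lra.
Qed.

Lemma dca_optimality v : S v -> G y + dotv (v - y) t <= G v + 2 * D.
Proof.
move=> Sv; have := dev Sv; have := dev Sy; have := y_min Sv.
by rewrite !ler_norml dotvBl (dotvC t y) (dotvC t v); lra.
Qed.

End DescentStep.

(** * Limit points *)

Section Subsequences.

Lemma cvg_subseq_index (phi : nat -> nat) :
  (forall j, (j <= phi j)%N) -> phi @ \oo --> \oo.
Proof.
move=> phij; apply/cvgnyPge => A; near=> k.
by rewrite (leq_trans _ (phij k))//; near: k; exact: nbhs_infty_ge.
Unshelve. all: by end_near. Qed.

Lemma cluster_subseq {R : realType} {V : normedModType R} (u : nat -> V) (x : V) :
  cluster (u k @[k --> \oo]) x ->
  exists phi : nat -> nat, (forall j, (j <= phi j)%N) /\ u \o phi @ \oo --> x.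
Proof.
move=> cx.
have ex j : exists k, (j <= k)%N /\ `|x - u k| < j.+1%:R^-1.
  have [||_ [[k jk <-] xk]] :=
    cx [set u k | k in [set k | (j <= k)%N]] (ball x j.+1%:R^-1).
  - by exists j => // k jk; exists k.
  - by apply: nbhsx_ballx; rewrite invr_gt0.
  by exists k; split=> //; move: xk; rewrite -ball_normE.
have [phi phiP] := choice ex; exists phi; split; first by move=> j; have [] := phiP j.
apply/cvgrPdist_lt => e e0; near=> j.
apply: (lt_trans (phiP j).2).
near: j; exact: (near_infty_natSinv_lt (PosNum e0)).
Unshelve. all: by end_near. Qed.

End Subsequences.

Section LimitPoints.
Context {R : realType} {m : nat}.
Variables (S : set 'rV[R]_m) (G H : 'rV[R]_m -> \bar R).
Variables (w s sb : nat -> 'rV[R]_m) (D : nat -> R) (B : R).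
Local Open Scope ereal_scope.
Hypothesis S_closed : closed S.
Hypothesis wS : forall k, S (w k).
Hypothesis G_lsc : lower_semicontinuous G.
Hypothesis H_lsc : lower_semicontinuous H.
Hypothesis G_fin : forall x, S x -> G x \is a fin_num.
Hypothesis H_fin : forall x, S x -> H x \is a fin_num.
Hypothesis G_out : forall x, ~ S x -> G x = +oo.
Hypothesis H_out : forall x, ~ S x -> H x = +oo.
Hypothesis sb_bounded : forall k, (`|sb k| <= B)%R.
Hypothesis D0 : D @ \oo --> (0%R : R).
Hypothesis s_sb : (fun k => s k - sb k)%R @ \oo --> (0%R : 'rV[R]_m).
Hypothesis dw : (fun k => w k.+1 - w k)%R @ \oo --> (0%R : 'rV[R]_m).
Hypothesis optG : forall k v, S v ->
  (fine (G (w k.+1)) + dotv (v - w k.+1) (s k) <= fine (G v) + 2 * D k)%R.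
Hypothesis optH : forall k v, S v ->
  (fine (H (w k)) + dotv (v - w k) (sb k) <= fine (H v))%R.

(** The subgradients sb are bounded, so a further subsequence of them converges. *)
Let joint_subseq (ws : 'rV[R]_m) : cluster (w k @[k --> \oo]) ws ->
  exists (phi : nat -> nat) (p : 'rV[R]_m), [/\ forall j, (j <= phi j)%N,
    w \o phi @ \oo --> ws & sb \o phi @ \oo --> p].
Proof.
move=> /cluster_subseq[phi [phij wphi]].
have kB : compact [set x : 'rV[R]_m | (`|x| <= B)%R].
  apply: bounded_closed_compact.
    by exists B; split=> [|M BM x /= xB]; [exact: num_real|rewrite (le_trans xB)// ltW].
  apply: (@closed_comp _ _ (fun x : 'rV[R]_m => `|x|%R) [set r | (r <= B)%R]).
    by move=> x _; exact: norm_continuous.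
  exact: closed_le.
have [|p [_ cp]] := kB ((sb \o phi) @ \oo) _.
  by exists 0%N => // j _ /=; exact: sb_bounded.
have [psi [psij spsi]] := cluster_subseq cp.
exists (phi \o psi), p; split=> //.
  by move=> j; rewrite (leq_trans (psij j))// phij.
exact: (cvg_comp _ _ (cvg_subseq_index psij) wphi).
Qed.

(** A subgradient inequality at u k passes to the limit: lower semicontinuity is
    the right direction for the value at the base point. *)
Let lsc_limit (f : 'rV[R]_m -> \bar R) (u : nat -> 'rV[R]_m) (l : R^nat) ws c r :
  lower_semicontinuous f -> (forall k, f (u k) \is a fin_num) ->
  f ws \is a fin_num -> u @ \oo --> ws -> l @ \oo --> c ->
  (forall k, fine (f (u k)) <= r - l k)%R -> (fine (f ws) + c <= r)%R.
Proof.
move=> lscf fu fws uws lc h; apply/ler_addgt0Pr => e e0.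
have [V Vws Vf] : exists2 V, nbhs ws V & forall y, V y -> (fine (f ws) - e)%:E < f y.
  apply: lscf; rewrite -[ltRHS]fineK// lte_fin; lra.
have h1 : \forall k \near \oo, (l k <= r - fine (f ws) + e)%R.
  have nV : \forall k \near \oo, V (u k) by exact: uws _ Vws.
  apply: filterS nV => k /Vf; rewrite -[ltRHS]fineK// lte_fin => h2; have := h k; lra.
have : (c <= r - fine (f ws) + e)%R.
  by apply: (ler_cvg_to lc (cvg_cst _) h1).
lra.
Qed.

(** The limit p of the subgradients sb is also that of s, and belongs to both
    subdifferentials at ws. *)
Lemma limit_point_critical ws : cluster (w k @[k --> \oo]) ws ->
  critical_point G H ws.
Proof.
move=> cws.
have [phi [p [phij wphi sphi]]] := joint_subseq cws.
have phioo := cvg_subseq_index phij.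
have Sws : S ws.
  apply: S_closed => U /wphi[N _ NU]; exists (w (phi N)); split; first exact: wS.
  by have := NU N (leqnn N).
have w1phi : (fun j => w (phi j).+1) @ \oo --> ws.
  rewrite (_ : (fun _ => _) = (fun j => (w (phi j).+1 - w (phi j)) + w (phi j)))%R.
    rewrite -[X in _ --> X]add0r; apply: cvgD => //.
    exact: (cvg_comp _ _ phioo dw).
  by apply/funext => j; rewrite subrK.
have s1phi : s \o phi @ \oo --> p.
  rewrite (_ : s \o phi = (fun j => (s (phi j) - sb (phi j)) + sb (phi j)))%R.
    rewrite -[X in _ --> X]add0r; apply: cvgD => //.
    exact: (cvg_comp _ _ phioo s_sb).
  by apply/funext => j /=; rewrite subrK.
exists p; split; split.
- by rewrite ltey_eq G_fin.
- move=> v; have [Sv|Sv] := pselect (S v); last by rewrite (G_out Sv) leey.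
  rewrite -[G ws]fineK ?G_fin// -[G v]fineK ?G_fin// -EFinD lee_fin.
  apply: (@lsc_limit G (fun j => w (phi j).+1)
    (fun j => dotv (v - w (phi j).+1) (s (phi j)) - 2 * D (phi j))%R) => //.
  + by move=> k; exact: G_fin.
  + exact: G_fin.
  + rewrite -[X in _ --> X]subr0; apply: cvgB.
      by apply: cvg_dotv => //; apply: cvgB => //; exact: cvg_cst.
    rewrite -(mulr0 2%R); apply: cvgM; first exact: cvg_cst.
    exact: (cvg_comp _ _ phioo D0).
  + by move=> j; have := optG (phi j) Sv; lra.
- by rewrite ltey_eq H_fin.
- move=> v; have [Sv|Sv] := pselect (S v); last by rewrite (H_out Sv) leey.
  rewrite -[H ws]fineK ?H_fin// -[H v]fineK ?H_fin// -EFinD lee_fin.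
  apply: (@lsc_limit H (w \o phi)
    (fun j => dotv (v - w (phi j)) (sb (phi j)))%R) => //.
  + by move=> k; apply: H_fin; exact: wS.
  + exact: H_fin.
  + by apply: cvg_dotv => //; apply: cvgB => //; exact: cvg_cst.
  + by move=> j; have := optH (phi j) Sv; rewrite /=; lra.
Qed.

End LimitPoints.

(** * Uniform deviation over a compact convex set *)

Section FiniteNets.
Context {R : realType} {m : nat}.
Variable S : set 'rV[R]_m.
Hypothesis S_convex : convex_set (S : set (convex_lmodType 'rV[R]_m)).
Hypothesis S_compact : compact S.
Hypothesis S_neq0 : S !=set0.

(** What convexity, lower semicontinuity and boundedness of an extended real
    function with domain S mean for its real values over S. *)
Definition regular_on (f : 'rV[R]_m -> R) :=
  [/\ forall x y (t : R), S x -> S y -> 0 <= t <= 1 ->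
        f (t *: x + (1 - t) *: y) <= t * f x + (1 - t) * f y,
      exists M : R, forall x, S x -> f x <= M &
      forall x (e : R), S x -> 0 < e ->
        \forall y \near x, S y -> f x - e < f y].

(** The points u j = (1 - t_j) w + t_j v_j with t_j = 1 / (j + 1) come from
    homothetic nets.  Convexity gives f (u j) <= (1 - t_j) f w + t_j M and lower
    semicontinuity the converse inequality in the limit.  The sequence u serves
    all f at once, hence also sums and differences of such functions. *)
Lemma exists_dense_nets : exists L : nat -> seq 'rV[R]_m,
  [/\ forall j d, d \in L j -> S d,
      forall i j, (i <= j)%N -> {subset L i <= L j} &
      forall w, S w -> exists u : nat -> 'rV[R]_m,
        (forall j, u j \in L j) /\
        forall f, regular_on f -> f \o u @ \oo --> f w].
Proof.
have t01 j : 0 < (j.+1%:R^-1 : R) <= 1.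
  by rewrite invr_gt0 ltr0n/= invf_le1// ler1n.
have [net netP] := choice (fun j : nat =>
  finite_homothetic_net S_convex S_compact S_neq0 (t01 j)).
pose L j := flatten [seq net i | i <- iota 0 j.+1].
have netL j d : d \in net j -> d \in L j.
  move=> dj; apply/flattenP; exists (net j) => //.
  by apply: map_f; rewrite mem_iota add0n ltnSn.
exists L; split.
- move=> j d /flattenP[_ /mapP[i _ ->]]; exact: (netP i).1.
- move=> i j ij d /flattenP[_ /mapP[k ki ->]] dk; apply/flattenP.
  exists (net k) => //; apply: map_f; move: ki.
  by rewrite !mem_iota !add0n => /andP[_ ki]/=; rewrite (leq_trans ki).
move=> w Sw.
have /choice[v vP] : forall j : nat, exists v, S v /\
    (1 - j.+1%:R^-1) *: w + j.+1%:R^-1 *: v \in net j.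
  by move=> j; have [v Sv vj] := (netP j).2 w Sw; exists v.
pose t j : R := j.+1%:R^-1.
pose u j := (1 - t j) *: w + t j *: v j.
exists u; split; first by move=> j; apply: netL; exact: (vP j).2.
have Su j : S (u j) by apply: (netP j).1; exact: (vP j).2.
have t0 : t @ \oo --> (0 : R) by exact: cvg_harmonic.
have uw : u @ \oo --> w.
  have [B [Br SB]] := compact_bounded S_compact.
  have {}SB x : S x -> `|x| <= B + 1 by apply: SB; rewrite ltrDl.
  apply/cvgrPdist_lt => e e0.
  have B0 : 0 <= B + 1 by exact: le_trans (SB _ Sw).
  have Bp : 0 < (B + 1) + (B + 1) + 1 by lra.
  move/cvgrPdist_lt : t0 => /(_ (e / ((B + 1) + (B + 1) + 1))).
  rewrite divr_gt0// => /(_ isT); apply: filterS => j.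
  rewrite sub0r normrN ger0_norm; last by rewrite ltW//; have /andP[] := t01 j.
  rewrite ltr_pdivlMr// => tj.
  have -> : w - u j = t j *: (w - v j).
    rewrite /u scalerBl scale1r scalerBr opprD opprB addrA.
    by rewrite [w + _]addrC subrK.
  rewrite normrZ ger0_norm; last by rewrite ltW//; have /andP[] := t01 j.
  apply: le_lt_trans tj; rewrite ler_wpM2l//.
    by rewrite ltW//; have /andP[] := t01 j.
  rewrite (le_trans (ler_normB _ _))//.
  by have := SB _ Sw; have := SB _ (vP j).1; lra.
move=> f [cf [M fM] lf].
apply/cvgrPdist_le => e e0.
have le1 : \forall j \near \oo, f w - e < f (u j).
  have nV : \forall j \near \oo, S (u j) -> f w - e < f (u j).
    exact: uw _ (lf _ _ Sw e0).
  by apply: filterS nV => j; apply; exact: Su.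
have M0 : 0 < `|M - f w| + 1 by rewrite ltr_wpDl.
have le2 : \forall j \near \oo, t j < e / (`|M - f w| + 1).
  move/cvgrPdist_lt : t0 => /(_ (e / (`|M - f w| + 1))).
  rewrite divr_gt0// => /(_ isT); apply: filterS => j.
  by rewrite sub0r normrN; apply: le_lt_trans; exact: ler_norm.
apply: filterS2 le1 le2 => j h1; rewrite ltr_pdivlMr// => h2.
have /andP[tj0 tj1] := t01 j.
have := cf (v j) w (t j) (vP j).1 Sw.
rewrite addrC -/(u j) (ltW tj0) tj1 => /(_ isT) h3.
have := fM _ (vP j).1 => h4.
have h5 : t j * f (v j) <= t j * M by rewrite ler_wpM2l// ltW.
have h6 : t j * (M - f w) <= t j * `|M - f w| by rewrite ler_wpM2l ?ler_norm// ltW.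
rewrite -/(t j) in tj0 tj1 *.
rewrite ler_norml /=; apply/andP; split; lra.
Qed.

Lemma regular_onP (F : 'rV[R]_m -> \bar R) (f : 'rV[R]_m -> R) (M : R) :
  econvex F -> lower_semicontinuous F -> (forall x, S x -> F x = (f x)%:E) ->
  (forall x, S x -> f x <= M) -> regular_on f.
Proof.
move=> cF lF Ff fM; split; last 2 first.
- by exists M.
- move=> x e Sx e0.
  have [|V Vx VF] := lF x (f x - e); first by rewrite Ff// lte_fin ltrBlDr ltrDl.
  by apply: filterS Vx => y /VF + Sy; rewrite Ff// lte_fin.
move=> x y t Sx Sy t01; apply: (econvex_real cF Ff) => //.
exact: (convex_set_comb S_convex).
Qed.

Lemma cvg_sum_ord n (f : 'I_n -> 'rV[R]_m -> R) (u : nat -> 'rV[R]_m) w :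
  (forall i, f i \o u @ \oo --> f i w) ->
  (fun j => \sum_i f i (u j)) @ \oo --> \sum_i f i w.
Proof.
by move=> fu; apply: cvg_big => [|i _]; [exact: add_continuous|exact: fu].
Qed.

End FiniteNets.

(** Delta is the limit of the maxima over the increasing nets L j; symmetrization
    bounds the expectation of each of them, and monotone convergence that of the
    limit. *)
Section UniformDeviation.
Context {R : realType} {m : nat}.
Variable S : set 'rV[R]_m.
Hypothesis S_convex : convex_set (S : set (convex_lmodType 'rV[R]_m)).
Hypothesis S_compact : compact S.
Hypothesis S_neq0 : S !=set0.
Context d (T : measurableType d) (P : probability T R).
Context d' (X : measurableType d') (n : nat).
Variables (Z : T -> X) (V : 'I_n -> T -> X).
Hypothesis n_gt0 : (0 < n)%N.
Hypothesis mZ : measurable_fun setT Z.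
Hypothesis mV : forall i, measurable_fun setT (V i).
Hypothesis same_law : forall i A, measurable A ->
  P (V i @^-1` A) = P (Z @^-1` A).
Hypothesis indep : forall A : 'I_n -> set X, (forall i, measurable (A i)) ->
  P [set o | forall i, A i (V i o)] = (\prod_(i < n) P (V i @^-1` A i))%E.
Variables (phi : 'rV[R]_m -> X -> R) (Xi : set X) (rho : R).
Hypothesis mphi : forall w, measurable_fun setT (phi w).
Hypothesis iphi : forall w, P.-integrable setT (fun o => (phi w (Z o))%:E).
Hypothesis rho_ge0 : 0 <= rho.
Hypothesis VXi : {ae P, forall o, forall i, Xi (V i o)}.
Hypothesis phi_regular : forall x, Xi x -> regular_on S (phi ^~ x).
Let E w : R := \int[P]_o phi w (Z o).
Hypothesis E_regular : regular_on S E.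
Hypothesis rad : forall (D : seq 'rV[R]_m) (z : 'I_n -> X),
  (forall x, x \in D -> S x) -> (forall i, Xi (z i)) ->
  2 ^- n * \sum_(s : {ffun 'I_n -> bool})
      max_norm D (fun k => n%:R^-1 * \sum_i (-1) ^+ s i * phi k (z i)) <= rho.
Local Open Scope ereal_scope.

Lemma uniform_deviation : exists Delta : T -> \bar R,
  [/\ measurable_fun setT Delta, forall o, 0 <= Delta o,
      \int[P]_o Delta o <= (2 * rho)%:E &
      forall o, (forall i, Xi (V i o)) -> forall w, S w ->
        `|n%:R^-1 * \sum_i phi w (V i o) - E w|%:E <= Delta o].
Proof.
have [L [LS Lmono Ldense]] := exists_dense_nets S_convex S_compact S_neq0.
pose dev w o : R := (n%:R^-1 * \sum_i phi w (V i o) - E w)%R.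
pose M j o : \bar R := (max_norm (L j) (dev ^~ o))%:E.
have M0 j o : 0 <= M j o by rewrite lee_fin max_norm_ge0.
have mM j : measurable_fun setT (M j).
  apply/measurable_EFinP/measurable_max_norm => w.
  apply: measurable_funB => //; apply: measurable_funM => //.
  by apply: measurable_sum => i; exact: measurableT_comp.
have ndM o : {homo M ^~ o : i j / (i <= j)%N >-> i <= j}.
  move=> i j ij; rewrite lee_fin; apply: max_norm_le => [|k kL].
    exact: max_norm_ge0.
  exact: (@le_max_norm _ _ (L j) (dev ^~ o) k (Lmono _ _ ij _ kL)).
have cM o : M ^~ o @ \oo --> limn (M ^~ o).
  by apply: ereal_nondecreasing_is_cvgn => i j; exact: ndM.
exists (fun o => limn (M ^~ o)); split.
- by apply: (emeasurable_fun_cvg M) => // o _; exact: cM.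
- by move=> o; apply: lime_ge; [exact: cM|exact: nearW].
- rewrite monotone_convergence//.
  apply: lime_le.
    apply: ereal_nondecreasing_is_cvgn => i j ij.
    by apply: ge0_le_integral => // o _; exact: ndM.
  apply: nearW => j.
  apply: (@symmetrization _ _ _ P _ _ n Z V _ _ _ _ n_gt0 _ phi _ _ (L j) Xi rho) => //.
  by move=> z zXi; apply: rad => // x; exact: LS.
move=> o oXi w Sw; have [u [uL ucvg]] := Ldense w Sw.
have cdev : (fun j => `|dev (u j) o|%:E) @ \oo --> `|dev w o|%:E.
  apply: cvg_EFin; first by apply: nearW.
  apply: cvg_norm; apply: cvgB; last exact: ucvg E_regular.
  apply: cvgM; first exact: cvg_cst.
  apply: (@cvg_sum_ord _ _ _ (fun i x => phi x (V i o))) => i.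
  by apply: ucvg; exact: phi_regular.
rewrite -(cvg_lim _ cdev)//; apply: lime_le.
  by apply/cvg_ex; exists `|dev w o|%:E.
apply: nearW => j; apply: (@le_trans _ _ (M j o)).
  by rewrite lee_fin; exact: (@le_max_norm _ _ (L j) (dev ^~ o)).
apply: lime_ge; first exact: cM.
by near=> i; apply: ndM; near: i; exact: nbhs_infty_ge.
Unshelve. all: by end_near. Qed.

End UniformDeviation.

(** * Integrands and their means *)

Section Integrand.
Context {R : realType} {m n : nat}.
Context d (T : measurableType d) (P : probability T R).
Variables (S : set 'rV[R]_m) (Xi : set 'rV[R]_n) (Z : {RV P >-> 'rV[R]_n}).
Variable f : 'rV[R]_m -> 'rV[R]_n -> \bar R.
Hypothesis S_convex : convex_set (S : set (convex_lmodType 'rV[R]_m)).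
Hypothesis S_neq0 : S !=set0.
Hypothesis f_meas : measurable_fun setT (fun p : 'rV[R]_m * 'rV[R]_n => f p.1 p.2).
Hypothesis f_fin : forall w z, S w -> Xi z -> f w z \is a fin_num.
Hypothesis f_out : forall w z, ~ (S w /\ Xi z) -> f w z = +oo%E.
Hypothesis f_int : forall w, S w -> P.-integrable setT (fun o => f w (Z o)).
Local Open Scope ereal_scope.

Lemma integrandE w z : S w -> Xi z -> f w z = (fine (f w z))%:E.
Proof. by move=> Sw Xz; rewrite fineK// f_fin. Qed.

Lemma measurable_integrand w : measurable_fun setT (f w).
Proof. exact: (measurableT_comp f_meas (pair1_measurable w)). Qed.

Lemma measurable_fine_integrand w : measurable_fun setT (fun z => fine (f w z)).
Proof. by apply: measurableT_comp => //; exact: measurable_integrand. Qed.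

(** For any w in S, the set Xi is the domain of f w. *)
Lemma integrand_domain_measurable : measurable Xi.
Proof.
have [w Sw] := S_neq0.
rewrite (_ : Xi = ~` (f w @^-1` [set +oo])).
  apply: measurableC; rewrite -[X in measurable X]setTI.
  by apply: measurable_integrand => //; exact: emeasurable_set1.
apply/seteqP; split=> z /=; first by move=> Xz; rewrite integrandE.
by move=> fz; apply: contrapT => Xz; apply: fz; apply: f_out; case.
Qed.

(** Integrability of f w (Z) excludes the value +oo, which f takes outside Xi. *)
Lemma ae_in_integrand_domain : {ae P, forall o, Xi (Z o)}.
Proof.
have [w Sw] := S_neq0.
have := integrable_ae measurableT (f_int Sw); apply: filterS => o /(_ I) fo.
by apply: contrapT => Xo; move: fo; rewrite f_out//; case.
Qed.

(** As fine maps +oo to 0, this also covers the points w outside S. *)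
Lemma integrable_fine_integrand w :
  P.-integrable setT (fun o => (fine (f w (Z o)))%:E).
Proof.
have [Sw|Sw] := pselect (S w); last first.
  rewrite (_ : (fun _ => _) = cst 0); first exact: integrable0.
  by apply/funext => o; rewrite f_out//; case.
apply: le_integrable (f_int Sw) => //.
  by apply/measurable_EFinP; apply: measurableT_comp (measurable_fine_integrand w) _.
by move=> o _; case: (f w (Z o)) => [r| |] //=; rewrite normr0 leey.
Qed.

Lemma mean_fun_fin w : S w ->
  mean_fun Z f w = (\int[P]_o fine (f w (Z o)))%R%:E.
Proof.
move=> Sw; rewrite EFin_Rintegral; last exact: integrable_fine_integrand.
apply: ae_eq_integral => //.
- exact: measurableT_comp (measurable_integrand w) _.
- by apply/measurable_EFinP; apply: measurableT_comp (measurable_fine_integrand w) _.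
- by apply: filterS ae_in_integrand_domain => o Xo _; exact: integrandE.
Qed.

Lemma mean_fun_out w : ~ S w -> mean_fun Z f w = +oo.
Proof.
move=> Sw; rewrite /mean_fun (eq_integral (cst +oo)).
  by rewrite integral_cst//= probability_setT mule1.
by move=> o _; rewrite f_out//; case.
Qed.

(** The positive part of v - u is a version of v - u with nonnegative values. *)
Lemma ae_le_Rintegral (u v : T -> R) : P.-integrable setT (EFin \o u) ->
  P.-integrable setT (EFin \o v) -> {ae P, forall o, (u o <= v o)%R} ->
  (\int[P]_o u o <= \int[P]_o v o)%R.
Proof.
move=> iu iv uv; rewrite -lee_fin !EFin_Rintegral// -sube_ge0; last first.
  by apply/orP; right; exact: integrable_fin_num.
rewrite -integralB//.
rewrite (ae_eq_integral (fun o => maxe 0 ((v o)%:E - (u o)%:E)))//.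
- by apply: integral_ge0 => o _; rewrite le_max lexx.
- by apply: emeasurable_funB; [exact: measurable_int iv|exact: measurable_int iu].
- apply: measurable_maxe => //.
  by apply: emeasurable_funB; [exact: measurable_int iv|exact: measurable_int iu].
- apply: filterS uv => o uvo _; apply/esym/max_idPr.
  by rewrite -EFinB lee_fin subr_ge0.
Qed.

Hypothesis f_convex : forall z, Xi z -> econvex (f ^~ z).
Hypothesis f_lsc : forall z, Xi z -> lower_semicontinuous (f ^~ z).

Lemma integrand_convex z x y (t : R) : Xi z -> S x -> S y -> (0 <= t <= 1)%R ->
  (fine (f (t *: x + (1 - t) *: y) z) <=
    t * fine (f x z) + (1 - t) * fine (f y z))%R.
Proof.
move=> Xz Sx Sy t01.
apply: (@econvex_real _ _ (f ^~ z) S (fun w => fine (f w z))) => //.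
- exact: f_convex.
- by move=> w Sw; exact: integrandE.
- exact: convex_set_comb.
Qed.

Lemma mean_convex x y (t : R) : S x -> S y -> (0 <= t <= 1)%R ->
  (\int[P]_o fine (f (t *: x + (1 - t) *: y)%R (Z o)) <=
    t * \int[P]_o fine (f x (Z o)) + (1 - t) * \int[P]_o fine (f y (Z o)))%R.
Proof.
move=> Sx Sy t01.
rewrite -!RintegralZl//; try exact: integrable_fine_integrand.
have iZ (c : R) w : P.-integrable setT (fun o => (c * fine (f w (Z o)))%:E).
  rewrite (_ : (fun _ => _) = fun o => c%:E * (fine (f w (Z o)))%:E).
    by apply: integrableZl => //; exact: integrable_fine_integrand.
  by apply/funext => o; rewrite EFinM.
rewrite -RintegralD//; [|exact: iZ|exact: iZ].
apply: ae_le_Rintegral.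
- exact: integrable_fine_integrand.
- rewrite (_ : _ \o _ = fun o => (t * fine (f x (Z o)))%:E +
      ((1 - t) * fine (f y (Z o)))%:E)//.
  by apply: integrableD => //; exact: iZ.
- by apply: filterS ae_in_integrand_domain => o Xo; exact: integrand_convex.
Qed.

Lemma regular_integrand (M : 'rV[R]_n -> R) z :
  (forall w, S w -> Xi z -> `|f w z| <= (M z)%:E) -> Xi z ->
  regular_on S (fun w => fine (f w z)).
Proof.
move=> fM Xz.
apply: (@regular_onP _ _ _ S_convex (f ^~ z) _ (M z)) => //.
- exact: f_convex.
- exact: f_lsc.
- by move=> x Sx; exact: integrandE.
- move=> x Sx; have := fM x Sx Xz; rewrite integrandE// lee_fin.
  by apply: le_trans; exact: ler_norm.
Qed.

Lemma regular_mean (M : 'rV[R]_n -> R) :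
  lower_semicontinuous (mean_fun Z f) ->
  P.-integrable setT (fun o => (M (Z o))%:E) ->
  (forall w z, S w -> Xi z -> `|f w z| <= (M z)%:E) ->
  regular_on S (fun w => \int[P]_o fine (f w (Z o)))%R.
Proof.
move=> lsc iM fM; split.
- by move=> x y t Sx Sy t01; exact: mean_convex.
- exists (\int[P]_o M (Z o))%R => w Sw; apply: ae_le_Rintegral => //.
    exact: integrable_fine_integrand.
  apply: filterS ae_in_integrand_domain => o Xo; have := fM w _ Sw Xo.
  by rewrite integrandE// lee_fin; apply: le_trans; exact: ler_norm.
- move=> x e Sx e0.
  have [|V Vx VF] := lsc x (\int[P]_o fine (f x (Z o)) - e)%R.
    by rewrite mean_fun_fin// lte_fin ltrBlDr ltrDl.
  by apply: filterS Vx => y /VF + Sy; rewrite mean_fun_fin// lte_fin.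
Qed.

End Integrand.

(** * Rademacher averages *)

Section Rademacher.
Context {R : realType} {m n : nat}.
Variables (S : set 'rV[R]_m) (Xi : set 'rV[R]_n).
Variable g : 'rV[R]_m -> 'rV[R]_n -> \bar R.
Hypothesis S_neq0 : S !=set0.
Hypothesis g_fin : forall w z, S w -> Xi z -> g w z \is a fin_num.

Lemma rademacher_max_norm_le l (rho : R) (D : seq 'rV[R]_m)
    (z : 'I_l -> 'rV[R]_n) :
  (rademacher S Xi g l <= rho%:E)%E ->
  (forall x, x \in D -> S x) -> (forall i, Xi (z i)) ->
  2 ^- l * \sum_(s : {ffun 'I_l -> bool})
    max_norm D (fun w => l%:R^-1 * \sum_i (-1) ^+ s i * fine (g w (z i))) <= rho.
Proof.
move=> rad DS zXi; rewrite -lee_fin; apply: le_trans rad.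
apply: (@le_trans _ _ (rademacher_avg S g z)); last first.
  by apply: ereal_sup_ubound; exists z.
rewrite /rademacher_avg EFinM -sumEFin lee_wpmul2l ?lee_fin ?invr_ge0 ?exprn_ge0//.
apply: lee_sum => s _.
set A := (X in ereal_sup X).
have wA w : S w ->
    A `|(l%:R^-1 * \sum_i (-1) ^+ s i * fine (g w (z i)))%R|%:E.
  move=> Sw; exists w => //; rewrite -abse_EFin EFinM -sumEFin.
  congr (`| _ * _ |)%E; apply: eq_bigr => i _.
  by rewrite EFinM fineK// g_fin.
have [w0 Sw0] := S_neq0.
have sup0 : (0 <= ereal_sup A)%E.
  by apply: le_trans (ereal_sup_ubound (wA _ Sw0)); rewrite lee_fin.
rewrite /max_norm big_seq_cond.
apply: (big_ind (fun r : R => (r%:E <= ereal_sup A)%E)) => //.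
- by move=> r1 r2 h1 h2; rewrite EFin_max ge_max h1.
- by move=> w /andP[wD _]; apply: ereal_sup_ubound; exact: wA (DS _ wD).
Qed.

End Rademacher.

(** * Distribution of the strong convexity between G and H *)

Section StrongConvexitySplit.
Context {R : realType} {m n : nat}.
Variables (S : set 'rV[R]_m) (Xi : set 'rV[R]_n).
Variable g : 'rV[R]_m -> 'rV[R]_n -> \bar R.
Variables (H : 'rV[R]_m -> \bar R) (eta : 'rV[R]_m -> R).
Hypothesis S_convex : convex_set (S : set (convex_lmodType 'rV[R]_m)).
Hypothesis gE : forall w z, S w -> Xi z -> g w z = (fine (g w z))%:E.
Hypothesis HE : forall w, S w -> H w = (eta w)%:E.
Hypothesis g_convex : forall z, Xi z -> econvex (g ^~ z).
Hypothesis eta_convex : forall x y (t : R), S x -> S y -> 0 <= t <= 1 ->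
  eta (t *: x + (1 - t) *: y) <= t * eta x + (1 - t) * eta y.

Lemma half_compl : 1 - 2^-1 = 2^-1 :> R. Proof. by field. Qed.

Lemma half01 : (0 <= 2^-1 :> R) && (2^-1 <= 1 :> R).
Proof. by apply/andP; split; lra. Qed.

Lemma midpoint_in x y : S x -> S y -> S (2^-1 *: x + 2^-1 *: y).
Proof.
by move=> Sx Sy; have := convex_set_comb S_convex Sx Sy half01; rewrite half_compl.
Qed.

Lemma lte0_real (x : \bar R) : (0 < x)%E -> exists2 r : R, 0 < r & (r%:E < x)%E.
Proof.
case: x => [r| |]//; last by exists 1 => //; rewrite ltry.
by rewrite lte_fin => r0; exists (r / 2); rewrite ?divr_gt0// lte_fin; lra.
Qed.

(** A positive sum of moduli has a positive term; a positive constant is assigned to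
    the corresponding function and 0 to the other.  This also covers infinite
    moduli. *)
Lemma strong_convexity_split :
  (0 < strong_convexity_modulus H +
     ereal_inf [set strong_convexity_modulus (g ^~ z) | z in Xi])%E ->
  exists cG cH : R, [/\ 0 < cG + cH,
    forall x y z, S x -> S y -> Xi z ->
      fine (g (2^-1 *: x + 2^-1 *: y) z) <=
        (fine (g x z) + fine (g y z)) / 2 - cG * enorm (y - x) ^+ 2 &
    forall x y, S x -> S y ->
      eta (2^-1 *: x + 2^-1 *: y) <=
        (eta x + eta y) / 2 - cH * enorm (y - x) ^+ 2].
Proof.
move=> pos.
have [H0|H0] := ltP 0%E (strong_convexity_modulus H).
  have [mu mu0 muH] := lte0_real H0.
  exists 0, (mu / 8); split; first by rewrite add0r divr_gt0.
  - move=> x y z Sx Sy Xz; rewrite mul0r subr0.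
    have := econvex_real (g_convex Xz) (fun w Sw => gE Sw Xz) Sx Sy.
    move=> /(_ 2^-1); rewrite half_compl => /(_ (midpoint_in Sx Sy) half01).
    by lra.
  - move=> x y Sx Sy.
    exact: (strong_convexity_midpoint muH (ltW mu0) HE Sx Sy (midpoint_in Sx Sy)).
have inf0 : (0 < ereal_inf [set strong_convexity_modulus (g ^~ z) | z in Xi])%E.
  rewrite ltNge; apply/negP => inf0; move: pos.
  by rewrite ltNge; apply/negP/negPn; exact: adde_le0.
have [mu mu0 muI] := lte0_real inf0.
exists (mu / 8), 0; split; first by rewrite addr0 divr_gt0.
- move=> x y z Sx Sy Xz.
  apply: (@strong_convexity_midpoint _ _ (g ^~ z) S (fun w => fine (g w z))) => //.
  + by apply: (lt_le_trans muI); apply: ereal_inf_lbound; exists z.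
  + exact: ltW.
  + by move=> w Sw; exact: gE.
  + exact: midpoint_in.
- move=> x y Sx Sy; rewrite mul0r subr0.
  have := eta_convex Sx Sy half01; rewrite half_compl.
  by lra.
Qed.

End StrongConvexitySplit.

(** * Stochastic subgradients *)

Section SubgradientNoise.
Context {R : realType} {m n : nat}.
Context d (T : measurableType d) (P : probability T R).
Variables (S : set 'rV[R]_m) (Xi : set 'rV[R]_n) (Z : {RV P >-> 'rV[R]_n}).
Variables (tau : 'rV[R]_m -> 'rV[R]_n -> 'rV[R]_m) (ttau : 'rV[R]_n -> R).
Hypothesis mS : measurable S.
Hypothesis mXi : measurable Xi.
Hypothesis tau_meas : measurable_fun (S `*` Xi) (fun p => tau p.1 p.2).
Hypothesis ttau_meas : measurable_fun setT ttau.
Hypothesis ttau_int : P.-integrable setT (fun o => (ttau (Z o) ^+ 2)%:E).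
Hypothesis tau_le : forall w z, S w -> Xi z -> enorm (tau w z) <= ttau z.

(** Extension by 0 outside S and Xi, where tau is arbitrary: it is measurable and
    bounded everywhere, which matters because the iterates may leave S on a
    null set. *)
Definition cut_coord (c : 'I_m) (w : 'rV[R]_m) (z : 'rV[R]_n) : R :=
  if `[< S w /\ Xi z >] then tau w z ord0 c else 0.

Lemma cut_coordE c w z : S w -> Xi z -> cut_coord c w z = tau w z ord0 c.
Proof. by move=> Sw Xz; rewrite /cut_coord asboolT. Qed.

Lemma measurable_cut_coord c :
  measurable_fun setT (fun p : 'rV[R]_m * 'rV[R]_n => cut_coord c p.1 p.2).
Proof.
have mt : measurable_fun (S `*` Xi) (fun p => tau p.1 p.2 ord0 c).
  have mc : measurable_fun setT (fun v : 'rV[R]_m => v ord0 c).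
    by apply: continuous_measurable_mx => v; exact: coord_continuous.
  exact: (measurableT_comp mc tau_meas).
rewrite (_ : (fun _ => _) = (fun p => tau p.1 p.2 ord0 c) \_ (S `*` Xi)).
  by apply/(measurable_restrictT _ _).1 => //; exact: measurableX.
apply/funext => p; rewrite /cut_coord patchE.
by case: asboolP => h; [rewrite mem_set|rewrite memNset].
Qed.

Lemma cut_coord_le c w z : `|cut_coord c w z| <= `|ttau z|.
Proof.
rewrite /cut_coord; case: asboolP => [[Sw Xz]|_]; last by rewrite normr0.
rewrite (le_trans (coord_norm_le _ _))// (le_trans (tau_le Sw Xz))//.
exact: ler_norm.
Qed.

Definition mean_tau (w : 'rV[R]_m) : 'rV[R]_m :=
  \row_c \int[P]_o cut_coord c w (Z o).

Lemma integrable_ttau : P.-integrable setT (fun o => (ttau (Z o))%:E).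
Proof. by apply: integrable_of_sqr => //; exact: measurableT_comp. Qed.

Lemma integrable_cut_coord c w :
  P.-integrable setT (fun o => (cut_coord c w (Z o))%:E).
Proof.
apply: le_integrable integrable_ttau => //.
  apply/measurable_EFinP.
  have := measurableT_comp (measurable_cut_coord c) (pair1_measurable w).
  by move=> h; exact: (measurableT_comp h).
by move=> o _ /=; rewrite lee_fin cut_coord_le.
Qed.

Lemma mean_tau_bounded : exists B : R, forall w, `|mean_tau w| <= B.
Proof.
exists (\int[P]_o `|ttau (Z o)|) => w.
have iabs : P.-integrable setT (fun o => `|ttau (Z o)|%:E).
  by have := integrable_abse integrable_ttau.
rewrite [leLHS]/Num.norm /= mx_normrE; apply: bigmax_le => [|[i c] _].
  by apply: Rintegral_ge0.
rewrite [i]ord1 /mean_tau mxE (le_trans (le_normr_Rintegral _ _))//.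
  exact: integrable_cut_coord.
apply: le_Rintegral => //.
- by have := integrable_abse (integrable_cut_coord c w).
- by move=> o _; exact: cut_coord_le.
Qed.

Definition cut_tau (w : 'rV[R]_m) (z : 'rV[R]_n) : 'rV[R]_m :=
  \row_c cut_coord c w z.

Lemma cut_tauE w z : S w -> Xi z -> cut_tau w z = tau w z.
Proof. by move=> Sw Xz; apply/rowP => c; rewrite mxE cut_coordE. Qed.

Lemma integrable_dotv_cut_tau u w :
  P.-integrable setT (fun o => (dotv u (cut_tau w (Z o)))%:E).
Proof.
rewrite (_ : (fun _ => _) =
    (fun o => \sum_(c < m) (u ord0 c)%:E * (cut_coord c w (Z o))%:E)%E).
  apply: integrable_sum => // c _; apply: integrableZl => //.
  exact: integrable_cut_coord.
apply/funext => o; rewrite /dotv -sumEFin; apply: eq_bigr => c _.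
by rewrite mxE EFinM.
Qed.

Lemma Rintegral_dotv_cut_tau u w :
  \int[P]_o dotv u (cut_tau w (Z o)) = dotv u (mean_tau w).
Proof.
apply: EFin_inj; rewrite EFin_Rintegral; last exact: integrable_dotv_cut_tau.
rewrite (eq_integral
    (fun o => \sum_(c < m) (u ord0 c)%:E * (cut_coord c w (Z o))%:E)%E); last first.
  move=> o _; rewrite /dotv -sumEFin; apply: eq_bigr => c _.
  by rewrite mxE EFinM.
rewrite integral_sum//; last first.
  by move=> c; apply: integrableZl => //; exact: integrable_cut_coord.
rewrite /dotv -sumEFin; apply: eq_bigr => c _.
rewrite integralZl//; last exact: integrable_cut_coord.
by rewrite mxE EFinM EFin_Rintegral//; exact: integrable_cut_coord.
Qed.

(** The subgradient inequalities of the functions h(., z) at w are integrated. *)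
Lemma mean_tau_subgradient (h : 'rV[R]_m -> 'rV[R]_n -> \bar R) w v :
  (forall z, Xi z -> subdiff (h ^~ z) w (tau w z)) ->
  (forall w z, S w -> Xi z -> h w z = (fine (h w z))%:E) ->
  (forall w, P.-integrable setT (fun o => (fine (h w (Z o)))%:E)) ->
  {ae P, forall o, Xi (Z o)} -> S w -> S v ->
  \int[P]_o fine (h w (Z o)) + dotv (v - w) (mean_tau w) <=
  \int[P]_o fine (h v (Z o)).
Proof.
move=> sub hE ih aeXi Sw Sv.
rewrite -Rintegral_dotv_cut_tau -RintegralD; [|by []|exact: ih|exact: integrable_dotv_cut_tau].
apply: ae_le_Rintegral => //.
- rewrite (_ : _ \o _ = fun o => ((fine (h w (Z o)))%:E +
      (dotv (v - w) (cut_tau w (Z o)))%:E)%E)//.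
  by apply: integrableD; [by []|exact: ih|exact: integrable_dotv_cut_tau].
- exact: ih.
- apply: filterS aeXi => o Xo; rewrite cut_tauE//.
  have [_ /(_ v)] := sub _ Xo.
  by rewrite (hE w)// (hE v)// -EFinD lee_fin.
Qed.

Section Minibatch.
Variables (l : nat) (V : 'I_l -> {RV P >-> 'rV[R]_n}) (W : {RV P >-> 'rV[R]_m}).
Hypothesis l_gt0 : (0 < l)%N.
Hypothesis same_law : forall i A, measurable A ->
  P (V i @^-1` A) = P (Z @^-1` A).
Hypothesis indep : forall A : 'I_l -> set 'rV[R]_n, (forall i, measurable (A i)) ->
  P [set o | forall i, A i (V i o)] = (\prod_(i < l) P (V i @^-1` A i))%E.
Hypothesis indepW : forall (A : set 'rV[R]_m) (B : 'I_l -> set 'rV[R]_n),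
  measurable A -> (forall i, measurable (B i)) ->
  P (W @^-1` A `&` [set o | forall i, B i (V i o)]) =
  (P (W @^-1` A) * \prod_(i < l) P (V i @^-1` B i))%E.

Definition slope_noise (o : T) : R :=
  enorm (l%:R^-1 *: \sum_i cut_tau (W o) (V i o) - mean_tau (W o)) ^+ 2.

Let coord_noise c o : R := (l%:R^-1 * \sum_i cut_coord c (W o) (V i o) -
  \int[P]_o' cut_coord c (W o) (Z o')) ^+ 2.

Let slope_noiseE o : slope_noise o = \sum_c coord_noise c o.
Proof.
rewrite /slope_noise enorm_sqr; apply: eq_bigr => c _.
rewrite -expr2 /coord_noise !mxE summxE; congr ((_ * _ - _) ^+ 2).
by apply: eq_bigr => i _; rewrite mxE.
Qed.

Let measurable_coord_noise c : measurable_fun setT (coord_noise c).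
Proof.
apply: measurable_funX; apply: measurable_funB.
  apply: measurable_funM => //; apply: measurable_sum => i.
  have mWV : measurable_fun setT (fun o => (W o, V i o)).
    by apply: measurable_fun_pair.
  exact: (measurableT_comp (measurable_cut_coord c) mWV).
have mR := measurable_fun_Rintegral P (measurable_funP Z) (measurable_cut_coord c).
exact: (measurableT_comp mR (measurable_funP W)).
Qed.

Lemma measurable_slope_noise : measurable_fun setT slope_noise.
Proof.
rewrite (_ : slope_noise = fun o => \sum_c coord_noise c o).
  by apply: measurable_sum => c; exact: measurable_coord_noise.
by apply/funext => o; exact: slope_noiseE.
Qed.

Lemma slope_noise_ge0 o : 0 <= slope_noise o.
Proof. exact: sqr_ge0. Qed.

(** Each of the m coordinates contributes a variance of order 1 / l. *)
Lemma integral_slope_noise_le :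
  (\int[P]_o (slope_noise o)%:E <=
   (m%:R * (l%:R^-1 * \int[P]_o ttau (Z o) ^+ 2)%R)%:E)%E.
Proof.
under eq_integral do rewrite slope_noiseE -sumEFin.
rewrite ge0_integral_sum//; last 2 first.
- by move=> c; apply/measurable_EFinP; exact: measurable_coord_noise.
- by move=> c o _; rewrite lee_fin sqr_ge0.
apply: (@le_trans _ _ (\sum_(c < m) (l%:R^-1 * \int[P]_o ttau (Z o) ^+ 2)%:E)%E).
  apply: lee_sum => c _.
  apply: le_trans (parametric_variance_mean (measurable_funP Z)
    (fun i => measurable_funP (V i)) same_law indep (measurable_funP W) indepW
    l_gt0 (measurable_cut_coord c) (b := fun z => `|ttau z|) _ _ _) _.
  - exact: measurableT_comp.
  - by move=> w z; exact: cut_coord_le.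
  - by under eq_fun do rewrite real_normK ?num_real//.
  - under eq_integral do rewrite real_normK ?num_real//.
    by rewrite EFinM EFin_Rintegral.
by rewrite sumEFin lee_fin sumr_const card_ord mulr_natl.
Qed.

End Minibatch.

End SubgradientNoise.

(** * Rates, almost sure statements and iterates *)

Section Auxiliary.
Context {R : realType}.

Lemma nneseries_cvg0 (f : R^nat) : (forall k, 0 <= f k) ->
  (\sum_(0 <= k <oo) (f k)%:E < +oo)%E -> f @ \oo --> (0 : R).
Proof.
move=> f0 foo; apply: cvg_series_cvg_0; apply: nondecreasing_is_cvgn.
  apply/nondecreasing_seqP => n; rewrite /series/= big_nat_recr//= lerDl.
  exact: f0.
exists (fine (\sum_(0 <= k <oo) (f k)%:E)%E) => _ [n _ <-].
rewrite -lee_fin fineK; last first.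
  by rewrite ge0_fin_numE// nneseries_ge0// => k _ _; rewrite lee_fin.
by rewrite /series/= -sumEFin; apply: nneseries_lim_ge => k _ _; rewrite lee_fin.
Qed.

(** Both exponents alpha and 1 are at least beta, and n is at least 1. *)
Lemma sampling_rate_le (n : nat) (Ng B alpha beta : R) : (0 < n)%N ->
  0 <= Ng -> 0 <= B -> beta = Num.min alpha 1 ->
  Ng / n%:R `^ alpha + B / n%:R <= (Ng + B) * n%:R `^ (- beta).
Proof.
move=> n0 Ng0 B0 betaE.
have n1 : 1 <= n%:R :> R by rewrite ler1n.
have [ba b1] : beta <= alpha /\ beta <= 1.
  by rewrite betaE !ge_min !lexx orbT.
rewrite mulrDl; apply: lerD; rewrite ler_wpM2l//.
  by rewrite -powRN ler_powR// lerN2.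
rewrite -[X in X^-1]powRr1 ?ler0n// -powRN ler_powR// lerN2//.
Qed.

Lemma ae_forall_ord d (T : measurableType d) (P : probability T R) (N : nat)
    (Q : 'I_N -> T -> Prop) :
  (forall i, {ae P, forall o, Q i o}) -> {ae P, forall o, forall i, Q i o}.
Proof.
move=> aeQ.
have : {ae P, forall o, forall j : nat, forall jN : (j < N)%N, Q (Ordinal jN) o}.
  apply/ae_foralln => j; have [jN|jN] := pselect (j < N)%N.
    apply: filterS (aeQ (Ordinal jN)) => o Qo jN'.
    by rewrite (bool_irrelevance jN' jN).
  by apply: aeW => o jN'; case: (jN jN').
by apply: filterS => o h [j jN]; exact: h.
Qed.

Lemma ae_full_set d (T : measurableType d) (P : probability T R) (Q : T -> Prop) :
  {ae P, forall o, Q o} ->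
  exists L : set T, [/\ measurable L, P L = 1%E & forall o, L o -> Q o].
Proof.
move=> [B [mB PB QB]]; exists (~` B); split.
- exact: measurableC.
- by rewrite probability_setC// PB sube0.
- by move=> o nB; apply: contrapT => nQ; apply: nB; exact: QB.
Qed.

End Auxiliary.

Section Iterates.
Context {R : realType} {m n : nat}.
Context d (T : measurableType d) (P : probability T R).
Variables (S : set 'rV[R]_m) (Xi : set 'rV[R]_n).
Variable g : 'rV[R]_m -> 'rV[R]_n -> \bar R.
Variable tau : 'rV[R]_m -> 'rV[R]_n -> 'rV[R]_m.
Variables (N : nat -> nat) (Zs : forall k, 'I_(N k) -> {RV P >-> 'rV[R]_n}).
Variable w : nat -> {RV P >-> 'rV[R]_m}.
Hypothesis N_gt0 : forall k, (0 < N k)%N.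
Hypothesis S_neq0 : S !=set0.
Hypothesis gE : forall w z, S w -> Xi z -> g w z = (fine (g w z))%:E.
Hypothesis g_out : forall w z, ~ (S w /\ Xi z) -> g w z = +oo%E.

Lemma dca_objective_fin k o v : (forall i : 'I_(N k), Xi (Zs i o)) -> S v ->
  dca_objective Zs w g tau k o v =
  ((N k)%:R^-1 * \sum_(i < N k) fine (g v (Zs i o))
    - dotv (dca_slope Zs w tau k o) v)%:E.
Proof.
move=> Xo Sv; rewrite /dca_objective EFinB EFinM.
rewrite (eq_bigr (fun i => (fine (g v (Zs i o)))%:E)) ?sumEFin// => i _.
exact: gE.
Qed.

Lemma dca_objective_out k o v : ~ S v -> dca_objective Zs w g tau k o v = +oo%E.
Proof.
move=> Sv; rewrite /dca_objective.
rewrite (eq_bigr (fun=> +oo%E)); last by move=> i _; rewrite g_out//; case.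
rewrite (bigD1 (Ordinal (N_gt0 k)))//= addye; last first.
  by rewrite gt_eqF// (@lt_le_trans _ _ 0%E)// ?ltNy0// sume_ge0.
by rewrite gt0_muley ?lte_fin ?invr_gt0 ?ltr0n// addye.
Qed.

(** The objective is +oo outside S and finite on S. *)
Lemma argmin_in_domain k o y : (forall i : 'I_(N k), Xi (Zs i o)) ->
  argmin (dca_objective Zs w g tau k o) y -> S y.
Proof.
move=> Xo ymin; apply: contrapT => nSy; have [v Sv] := S_neq0.
by have := ymin v; rewrite (dca_objective_out _ _ nSy) dca_objective_fin.
Qed.

Lemma argmin_le k o y v : (forall i : 'I_(N k), Xi (Zs i o)) ->
  argmin (dca_objective Zs w g tau k o) y -> S v ->
  (N k)%:R^-1 * \sum_(i < N k) fine (g y (Zs i o))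
    - dotv (dca_slope Zs w tau k o) y <=
  (N k)%:R^-1 * \sum_(i < N k) fine (g v (Zs i o))
    - dotv (dca_slope Zs w tau k o) v.
Proof.
move=> Xo ymin Sv; have Sy := argmin_in_domain Xo ymin.
by have := ymin v; rewrite !dca_objective_fin// lee_fin.
Qed.

Lemma average_midpoint k o x y (c : R) : (forall i : 'I_(N k), Xi (Zs i o)) ->
  (forall z, Xi z -> fine (g (2^-1 *: x + 2^-1 *: y) z) <=
    (fine (g x z) + fine (g y z)) / 2 - c) ->
  (N k)%:R^-1 * \sum_(i < N k) fine (g (2^-1 *: x + 2^-1 *: y) (Zs i o)) <=
  ((N k)%:R^-1 * \sum_(i < N k) fine (g x (Zs i o)) +
   (N k)%:R^-1 * \sum_(i < N k) fine (g y (Zs i o))) / 2 - c.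
Proof.
move=> Xo mid.
have -> : ((N k)%:R^-1 * \sum_(i < N k) fine (g x (Zs i o)) +
   (N k)%:R^-1 * \sum_(i < N k) fine (g y (Zs i o))) / 2 - c =
   (N k)%:R^-1 * \sum_(i < N k)
     ((fine (g x (Zs i o)) + fine (g y (Zs i o))) / 2 - c).
  rewrite sumrB sumr_const card_ord -mulr_suml big_split/= -(mulr_natl c).
  by field; rewrite pnatr_eq0 -lt0n.
by rewrite ler_wpM2l ?invr_ge0//; apply: ler_sum => i _; exact: mid.
Qed.

Section FreshSamples.
Variables (Z : {RV P >-> 'rV[R]_n}) (k : nat).
Hypothesis fresh : fresh_samples Zs w Z k.

Lemma fresh_same_law (i : 'I_(N k)) A : measurable A ->
  P (Zs i @^-1` A) = P (Z @^-1` A).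
Proof. by move=> mA; exact: (fresh.1 i A mA). Qed.

Let capE (A : 'I_(N k) -> set 'rV[R]_n) :
  \bigcap_(i in [set: 'I_(N k)]) (Zs i @^-1` A i) =
  [set o | forall i, A i (Zs i o)].
Proof. by apply/seteqP; split=> t /= h i; [exact: h|move=> _; exact: h]. Qed.

(** The current iterate is measurable with respect to the past. *)
Lemma fresh_indep_past (A : set 'rV[R]_m) (B : 'I_(N k) -> set 'rV[R]_n) :
  measurable A -> (forall i, measurable (B i)) ->
  P (w k @^-1` A `&` [set o | forall i, B i (Zs i o)]) =
  (P (w k @^-1` A) * \prod_(i < N k) P (Zs i @^-1` B i))%E.
Proof.
move=> mA mB; rewrite -capE; apply: fresh.2 => //.
apply: sub_sigma_algebra; right; exists k => //=.
by exists A => //; rewrite setTI.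
Qed.

Lemma fresh_indep (B : 'I_(N k) -> set 'rV[R]_n) : (forall i, measurable (B i)) ->
  P [set o | forall i, B i (Zs i o)] = (\prod_(i < N k) P (Zs i @^-1` B i))%E.
Proof.
move=> mB; have := fresh_indep_past measurableT mB.
by rewrite preimage_setT setTI probability_setT mul1e.
Qed.

Lemma fresh_in_support : measurable Xi -> {ae P, forall o, Xi (Z o)} ->
  {ae P, forall o, forall i : 'I_(N k), Xi (Zs i o)}.
Proof.
move=> mXi [B [mB PB XB]]; apply: ae_forall_ord => i.
have mC : measurable (~` Xi) by exact: measurableC.
have PC : P (Zs i @^-1` (~` Xi)) = 0%E.
  rewrite fresh_same_law//; apply/eqP; rewrite -measure_le0 -PB.
  apply: le_measure; rewrite ?inE//.
  by rewrite -[X in measurable X]setTI; exact: measurable_funP.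
exists (Zs i @^-1` (~` Xi)); split=> //.
by rewrite -[X in measurable X]setTI; exact: measurable_funP.
Qed.

End FreshSamples.
End Iterates.

(** * Convergence of the algorithm *)

Theorem theorem1 (R : realType) (m n : nat)
  (d : measure_display) (T : measurableType d) (P : probability T R)
  (P_complete : measure_is_complete P)
  (S : set 'rV[R]_m)
  (S_neq0 : S !=set0) (S_compact : compact S)
  (S_convex : convex_set (S : set (convex_lmodType 'rV[R]_m)))
  (Z : {RV P >-> 'rV[R]_n})
  (Xi : set 'rV[R]_n) (Xi_def : Xi = msupp (distribution P Z))
  (g h : 'rV[R]_m -> 'rV[R]_n -> \bar R)
  (g_meas : measurable_fun [set: 'rV[R]_m * 'rV[R]_n] (fun p => g p.1 p.2))
  (h_meas : measurable_fun [set: 'rV[R]_m * 'rV[R]_n] (fun p => h p.1 p.2))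
  (g_fin : forall w z, S w -> Xi z -> g w z \is a fin_num)
  (h_fin : forall w z, S w -> Xi z -> h w z \is a fin_num)
  (g_out : forall w z, ~ (S w /\ Xi z) -> g w z = +oo%E)
  (h_out : forall w z, ~ (S w /\ Xi z) -> h w z = +oo%E)
  (g_int : forall w, S w -> P.-integrable [set: T] (fun o => g w (Z o)))
  (h_int : forall w, S w -> P.-integrable [set: T] (fun o => h w (Z o)))
  (g_convex : forall z, Xi z -> econvex (g ^~ z))
  (h_convex : forall z, Xi z -> econvex (h ^~ z))
  (g_lsc : forall z, Xi z -> lower_semicontinuous (g ^~ z))
  (h_lsc : forall z, Xi z -> lower_semicontinuous (h ^~ z))
  (G H F : 'rV[R]_m -> \bar R)
  (G_def : G = mean_fun Z g) (H_def : H = mean_fun Z h)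
  (F_def : F = dc_diff G H)
  (G_lsc : lower_semicontinuous G) (H_lsc : lower_semicontinuous H)
  (* (A1) *)
  (A1i : forall z, Xi z -> [set w | subdiff (h ^~ z) w !=set0] = S)
  (A1ii : (0 < strong_convexity_modulus H +
            ereal_inf [set strong_convexity_modulus (g ^~ z) | z in Xi])%E)
  (tau : 'rV[R]_m -> 'rV[R]_n -> 'rV[R]_m) (ttau : 'rV[R]_n -> R)
  (tau_meas : measurable_fun (S `*` Xi) (fun p => tau p.1 p.2))
  (tau_subdiff : forall w z, S w -> Xi z -> subdiff (h ^~ z) w (tau w z))
  (ttau_meas : measurable_fun [set: 'rV[R]_n] ttau)
  (ttau_int : P.-integrable [set: T] (fun o => (ttau (Z o) ^+ 2)%:E))
  (tau_le : forall w z, S w -> Xi z -> enorm (tau w z) <= ttau z)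
  (A1iv : (ereal_sup [set `|F w| | w in S] < +oo)%E)
  (* (A2) *)
  (tg : 'rV[R]_n -> R)
  (tg_meas : measurable_fun [set: 'rV[R]_n] tg)
  (tg_int : P.-integrable [set: T] (fun o => (tg (Z o))%:E))
  (g_le : forall w z, S w -> Xi z -> (`|g w z| <= (tg z)%:E)%E)
  (Ng alpha : R) (Ng_gt0 : 0 < Ng) (alpha_gt0 : 0 < alpha)
  (A2ii : forall k : nat, (1 <= k)%N ->
    (rademacher S Xi g k <= (Ng / k%:R `^ alpha)%:E)%E)
  (* sample sizes *)
  (beta : R) (beta_def : beta = Num.min alpha 1)
  (N : nat -> nat) (N_gt0 : forall k, (0 < N k)%N)
  (N_sum : (\sum_(1 <= k <oo) ((N k)%:R `^ (- beta))%:E < +oo)%E)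
  (* the algorithm *)
  (Zs : forall k, 'I_(N k) -> {RV P >-> 'rV[R]_n})
  (w : nat -> {RV P >-> 'rV[R]_m})
  (w_dca : online_stochastic_dca Zs w S Xi Z g tau) :
  [/\ exists Finf : T -> R,
        P.-integrable [set: T] (fun o => (Finf o)%:E) /\
        {ae P, forall o, F (w k o) @[k --> \oo] --> (Finf o)%:E},
      {ae P, forall o,
        (\sum_(1 <= k <oo) (enorm (w k.+1 o - w k o) ^+ 2)%:E < +oo)%E} &
      exists L : set T, [/\ measurable L, P L = 1%E &
        forall o, L o -> forall ws : 'rV[R]_m,
          cluster (w k o @[k --> \oo]) ws -> critical_point G H ws]].
Proof.
have [w0 Sw0] := S_neq0.
have S_closed : closed S by apply: compact_closed S_compact; exact: norm_hausdorff.
have mS : measurable S by exact: compact_measurable_mx.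
have gE := integrandE g_fin; have hE := integrandE h_fin.
have mXi : measurable Xi by exact: (integrand_domain_measurable S_neq0 g_meas g_fin g_out).
have aeXi : {ae P, forall o, Xi (Z o)}.
  exact: (ae_in_integrand_domain S_neq0 g_out g_int).
pose Gam v : R := \int[P]_o fine (g v (Z o)).
pose Eta v : R := \int[P]_o fine (h v (Z o)).
have GE v : S v -> G v = (Gam v)%:E.
  by move=> Sv; rewrite G_def (mean_fun_fin S_neq0 g_meas g_fin g_out g_int).
have HE v : S v -> H v = (Eta v)%:E.
  by move=> Sv; rewrite H_def (mean_fun_fin S_neq0 h_meas h_fin h_out h_int).
have Gout v : ~ S v -> G v = +oo%E.
  by move=> Sv; rewrite G_def; exact: (mean_fun_out _ g_out).
have Hout v : ~ S v -> H v = +oo%E.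
  by move=> Sv; rewrite H_def; exact: (mean_fun_out _ h_out).
have FE v : S v -> F v = (Gam v - Eta v)%:E.
  by move=> Sv; rewrite F_def /dc_diff GE// HE.
have [K FK] : exists K : R, forall v, S v -> `|Gam v - Eta v| <= K.
  have Fub v : S v -> (`|Gam v - Eta v|%:E <= ereal_sup [set `|F w| | w in S])%E.
    move=> Sv; apply: ereal_sup_ubound; exists v => //.
    by rewrite FE.
  exists (fine (ereal_sup [set `|F w| | w in S]%E)) => v Sv.
  rewrite -lee_fin fineK; first exact: Fub.
  rewrite ge0_fin_numE//; apply: le_trans (Fub _ Sv); exact: normr_ge0.
have eta_convex := mean_convex S_convex S_neq0 h_meas h_fin h_out h_int h_convex.
have [cG [cH [c_gt0 gmid hmid]]] :=
  strong_convexity_split S_convex gE HE g_convex eta_convex A1ii.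
have [w0S fresh step] := w_dca.
have same k := fresh_same_law (fresh k).
have indep k := fresh_indep (fresh k).
have indepW k := fresh_indep_past (fresh k).
have ae_samples k := fresh_in_support (fresh k) mXi aeXi.
have iphi := integrable_fine_integrand g_meas g_out g_int.
have rho_ge0 k : 0 <= Ng / (N k)%:R `^ alpha.
  by rewrite divr_ge0 ?powR_ge0// ltW.
have /choice[Delta DeltaP] : forall k, exists Delta : T -> \bar R,
    [/\ measurable_fun setT Delta, forall o, (0 <= Delta o)%E,
      (\int[P]_o Delta o <= (2 * (Ng / (N k)%:R `^ alpha))%:E)%E &
      forall o, (forall i : 'I_(N k), Xi (Zs k i o)) -> forall v, S v ->
        (`|(N k)%:R^-1 * \sum_(i < N k) fine (g v (Zs k i o)) - Gam v|%:E
          <= Delta o)%E].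
  move=> k.
  apply: (uniform_deviation S_convex S_compact S_neq0 (N_gt0 k)
    (measurable_funP Z) (fun i => measurable_funP (Zs k i)) (same k) (indep k)
    (fun v => measurable_fine_integrand g_meas v) iphi (rho_ge0 k) (ae_samples k)).
  - move=> z Xz; apply: (regular_integrand S_convex g_fin g_convex g_lsc _ Xz).
    by move=> v Sv; exact: g_le.
  - apply: (regular_mean S_convex S_neq0 g_meas g_fin g_out g_int g_convex _ tg_int).
      by rewrite -G_def.
    exact: g_le.
  - move=> D z DS zXi; apply: (rademacher_max_norm_le S_neq0 g_fin) => //.
    exact: A2ii.
(* The noise of the slope is defined everywhere through the extension of tau by 0;
   it is |t_k - tb(w_k)|^2 once the samples lie in Xi and w_k in S. *)
pose tbar v := mean_tau S Xi Z tau v.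
pose noise k o := slope_noise S Xi Z tau (fun i => Zs k i) (w k) o.
have mnoise k : measurable_fun setT (noise k).
  exact: (measurable_slope_noise Z mS mXi tau_meas).
have noise0 k o : 0 <= noise k o by exact: slope_noise_ge0.
pose B2 : R := \int[P]_o ttau (Z o) ^+ 2.
have B20 : 0 <= B2 by apply: Rintegral_ge0 => o _; exact: sqr_ge0.
have noiseE k : (\int[P]_o (noise k o)%:E <= (m%:R * ((N k)%:R^-1 * B2))%:E)%E.
  exact: (integral_slope_noise_le mS mXi tau_meas ttau_meas ttau_int tau_le
    (N_gt0 k) (same k) (indep k) (indepW k)).
pose X k o : \bar R := (Delta k o + (noise k o)%:E)%E.
have X0 k o : (0 <= X k o)%E.
  by have [_ D0 _ _] := DeltaP k; rewrite adde_ge0 ?lee_fin.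
have aeX : {ae P, forall o, (\sum_(0 <= k <oo) X k o < +oo)%E}.
  apply: (@ae_summable _ _ _ P X (2 * Ng + m%:R * B2)
    (fun k => (N k)%:R `^ (- beta))) => //.
  - move=> k; have [mD _ _ _] := DeltaP k.
    by apply: emeasurable_funD => //; exact/measurable_EFinP.
  - by rewrite addr_ge0 ?mulr_ge0// ltW.
  - move=> k; have [mD D0 ID _] := DeltaP k.
    rewrite ge0_integralD//; last 2 first.
      by move=> o _; rewrite lee_fin.
      exact/measurable_EFinP.
    apply: le_trans (leeD ID (noiseE k)) _; rewrite -EFinD lee_fin.
    have := @sampling_rate_le R (N k) (2 * Ng) (m%:R * B2) alpha beta (N_gt0 k).
    rewrite !mulr_ge0 ?(ltW Ng_gt0)// => /(_ isT isT beta_def).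
    by rewrite -[2 * _ / _]mulrA -[m%:R * B2 / _]mulrA [B2 / _]mulrC.
  - by rewrite nneseries_tail1// ltry.
have aeGood : {ae P, forall o, (forall k (i : 'I_(N k)), Xi (Zs k i o)) /\
    (\sum_(0 <= k <oo) X k o < +oo)%E}.
  apply: filterS2 aeX _; last by apply/ae_foralln => k; exact: ae_samples.
  by move=> o.
(* From here on a path in L is fixed and the reasoning is deterministic. *)
have [L [mL PL LP]] := ae_full_set aeGood.
have LX o (Lo : L o) k (i : 'I_(N k)) : Xi (Zs k i o) by exact: (LP o Lo).1.
have LS o : L o -> forall k, S (w k o).
  move=> Lo [|k]; first exact: w0S.
  exact: (argmin_in_domain N_gt0 S_neq0 gE g_out (LX o Lo k) (step o (LX o Lo) k)).
pose D k o : R := fine (Delta k o).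
have XE o : L o -> forall k, X k o = (D k o + noise k o)%:E.
  move=> Lo k; rewrite EFinD /X /D fineK//.
  have Xk := nneseries_lty_fin (X0^~ o) (LP o Lo).2 k.
  have [_ D0 _ _] := DeltaP k.
  rewrite ge0_fin_numE//; apply: (@le_lt_trans _ _ (X k o)).
    by rewrite leeDl// lee_fin.
  by rewrite Xk ltry.
have D0 k o : 0 <= D k o by have [_ D0 _ _] := DeltaP k; rewrite fine_ge0.
pose Gk k o v : R := (N k)%:R^-1 * \sum_(i < N k) fine (g v (Zs k i o)).
have dev o : L o -> forall k v, S v -> `|Gk k o v - Gam v| <= D k o.
  move=> Lo k v Sv; have [_ D0' _ /(_ _ (LX o Lo k) _ Sv)] := DeltaP k.
  rewrite -lee_fin /D => dle; rewrite fineK//.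
  rewrite ge0_fin_numE//; apply: (@le_lt_trans _ _ (X k o)).
    by rewrite leeDl// lee_fin.
  by rewrite XE// ltry.
have noiseD o : L o -> forall k,
    noise k o = enorm (dca_slope Zs w tau k o - tbar (w k o)) ^+ 2.
  move=> Lo k; rewrite /noise /slope_noise /dca_slope.
  congr (enorm (_ *: _ - _) ^+ 2); apply: eq_bigr => i _.
  by rewrite cut_tauE//; [exact: LS|exact: LX].
have tbar_sub v x : S v -> S x -> Eta v + dotv (x - v) (tbar v) <= Eta x.
  move=> Sv Sx; apply: (mean_tau_subgradient mS mXi tau_meas ttau_meas ttau_int
    tau_le _ hE _ aeXi Sv Sx).
    by move=> z Xz; exact: tau_subdiff.
  exact: (integrable_fine_integrand h_meas h_out h_int).
have mid_in o (Lo : L o) k := midpoint_in S_convex (LS o Lo k) (LS o Lo k.+1).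
have opt o (Lo : L o) k v (Sv : S v) :
    Gk k o (w k.+1 o) - dotv (dca_slope Zs w tau k o) (w k.+1 o) <=
    Gk k o v - dotv (dca_slope Zs w tau k o) v.
  exact: (argmin_le N_gt0 S_neq0 gE g_out (LX o Lo k) (step o (LX o Lo) k) Sv).
pose c := cG + cH.
pose a o k : R := Gam (w k o) - Eta (w k o).
pose b o k : R := enorm (w k.+1 o - w k o) ^+ 2.
pose x o k : R := 2 * D k o + noise k o / (4 * c).
have descent o : L o -> forall k, a o k.+1 <= a o k - c * b o k + x o k.
  move=> Lo k; rewrite /x (noiseD _ Lo).
  apply: (dca_descent_step (S := S) (Gk := Gk k o)) => //.
  - exact: LS.
  - exact: LS.
  - exact: mid_in.
  - exact: opt.
  - by move=> v Sv; apply: tbar_sub => //; exact: LS.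
  - apply: (average_midpoint N_gt0 (g := g) (x := w k o) (y := w k.+1 o)
      (LX o Lo k)) => z Xz.
    by apply: gmid => //; exact: LS.
  - by apply: hmid; exact: LS.
  - exact: dev.
have c4 : 0 <= (4 * c)^-1 by rewrite invr_ge0 mulr_ge0// ltW.
have x0 o k : 0 <= x o k by apply: addr_ge0; exact: mulr_ge0.
have Dnoise o : L o -> (\sum_(0 <= k <oo) (D k o + noise k o)%:E < +oo)%E.
  move=> Lo; rewrite (eq_eseriesr (g := X^~ o)); first exact: (LP o Lo).2.
  by move=> k _; rewrite XE.
have x_sum o : L o -> (\sum_(0 <= k <oo) (x o k)%:E < +oo)%E.
  move=> Lo; apply: (@le_lt_trans _ _
      (\sum_(0 <= k <oo) (2 + (4 * c)^-1)%:E * (D k o + noise k o)%:E)%E).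
    apply: lee_nneseries => k _; first by rewrite lee_fin.
    rewrite -EFinM lee_fin /x.
    have := mulr_ge0 c4 (D0 k o); have := noise0 k o.
    lra.
  rewrite nneseriesZl//; last by move=> k _; rewrite lee_fin addr_ge0.
  rewrite lte_mul_pinfty ?lee_fin//; last exact: Dnoise.
  exact: addr_ge0.
have aK o : L o -> forall k, `|a o k| <= K by move=> Lo k; apply/FK/LS.
have b0 o k : 0 <= b o k by exact: sqr_ge0.
have b_sum o : L o -> (\sum_(0 <= k <oo) (b o k)%:E < +oo)%E.
  move=> Lo.
  exact: (perturbed_descent_summable c_gt0 (b0 o) (x0 o) (aK o Lo) (descent o Lo) (x_sum o Lo)).
have a_cvg o : L o -> cvgn (a o).
  move=> Lo.
  exact: (perturbed_descent_cvg c_gt0 (b0 o) (x0 o) (aK o Lo) (descent o Lo) (x_sum o Lo)).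
have aeL : {ae P, forall o, L o}.
  exists (~` L); split=> //; first exact: measurableC.
  by rewrite probability_setC// PL subee.
split.
(* The indicator of L makes the approximations converge everywhere, so that their
   limit is measurable. *)
- pose Finf o : R := if `[< L o >] then limn (a o) else 0.
  pose fk k o : R := (fine (G (w k o)) - fine (H (w k o))) * \1_L o.
  have fkE o : L o -> forall k, fk k o = a o k.
    move=> Lo k; rewrite /fk indicE mem_set// mulr1.
    by rewrite GE ?HE//; exact: LS.
  have cfk o : fk ^~ o @ \oo --> Finf o.
    rewrite /Finf; case: asboolP => [Lo|nLo].
      rewrite (_ : fk^~ o = a o); first exact: a_cvg.
      by apply/funext => k; exact: fkE.
    rewrite (_ : fk^~ o = cst 0); first exact: cvg_cst.
    by apply/funext => k; rewrite /fk indicE memNset// mulr0.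
  exists Finf; split.
    apply: (le_integrable measurableT (f := EFin \o Finf) (g := cst K%:E)).
    + apply/measurable_EFinP.
      apply: (@measurable_fun_cvg _ _ _ _ fk) => // k.
      apply: measurable_funM; last exact: measurable_indic.
      have mGw (f : 'rV[R]_m -> \bar R) : lower_semicontinuous f ->
          measurable_fun setT (fun o => fine (f (w k o))).
        move=> lf; apply: measurableT_comp => //.
        exact: (measurableT_comp (lower_semicontinuous_measurable_mx lf)).
      by apply: measurable_funB; exact: mGw.
    + move=> o _ /=; rewrite lee_fin (le_trans _ (ler_norm K))//.
      rewrite /Finf; case: asboolP => [Lo|_].
        rewrite ler_norml; apply/andP; split.
          apply: limr_ge; first exact: a_cvg.
          by apply: nearW => k; have := aK o Lo k; rewrite ler_norml => /andP[].
        apply: limr_le; first exact: a_cvg.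
        by apply: nearW => k; have := aK o Lo k; rewrite ler_norml => /andP[].
      by rewrite normr0 (le_trans _ (FK _ Sw0)).
    + exact: finite_measure_integrable_cst.
  apply: filterS aeL => o Lo.
  rewrite (_ : (fun k => F (w k o)) = EFin \o fk^~ o).
    by apply: cvg_EFin; [exact: nearW|exact: cfk].
  by apply/funext => k /=; rewrite FE ?fkE//; exact: LS.
- apply: filterS aeL => o Lo; rewrite -(nneseries_tail1 (f := fun k => (b o k)%:E)).
  + exact: b_sum.
  + by move=> k; rewrite lee_fin.
  + by rewrite ltry.
- exists L; split=> // o Lo ws cws.
  have [B tB] := mean_tau_bounded mS mXi tau_meas ttau_meas ttau_int tau_le.
  have Dn0 : (fun k => D k o + noise k o) @ \oo --> (0 : R).
    by apply: nneseries_cvg0 (Dnoise o Lo) => k; rewrite addr_ge0.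
  apply: (limit_point_critical (S := S) (w := fun k => w k o)
    (s := fun k => dca_slope Zs w tau k o) (sb := fun k => tbar (w k o))
    (D := D^~ o) (B := B)) => //.
  + exact: LS.
  + by move=> v Sv; rewrite GE.
  + by move=> v Sv; rewrite HE.
  + apply: (squeeze_cvgr _ (cvg_cst 0) Dn0).
    by apply: nearW => k; rewrite D0 lerDl noise0.
  + apply: enorm_cvg0.
    apply: (squeeze_cvgr _ (cvg_cst 0) Dn0).
    by apply: nearW => k; rewrite sqr_ge0 -(noiseD _ Lo) lerDr D0.
  + by apply/enorm_cvg0/nneseries_cvg0; [exact: b0|exact: b_sum].
  + move=> k v Sv; rewrite !GE//=; last exact: LS.
    apply: (dca_optimality (S := S) (Gk := Gk k o)) => //.
    * exact: LS.
    * exact: opt.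
    * exact: dev.
  + move=> k v Sv; rewrite !HE//=; last exact: LS.
    by apply: tbar_sub => //; exact: LS.
Qed.
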